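(* Let $d\in\mathbb{N}$, $D_E^{\mathrm{s}}=D_V^{\mathrm{s}}=\mathrm{Vect}(\mathbb{N}^{d+1})$, $\lambda\in\mathbb{K}^{d+1}$, and let $\phi^\lambda$ be the endomorphism of $D_E^{\mathrm{s}}\otimes D_V^{\mathrm{s}}$ given by $\phi^\lambda(a\otimes b)=\sum_{l\leq\min(a,b)}\lambda^l\binom{b}{l}(a-l)\otimes(b-l)$ for $a,b\in\mathbb{N}^{d+1}$. Then the $D_E^{\mathrm{s}}$-multiple pre-Lie algebra $(\mathcal{T}(D_E^{\mathrm{s}},D_V^{\mathrm{s}}),\triangleleft^{\phi^\lambda})$ is freely generated by the one-vertex trees $\bullet\otimes b$, $b\in D_V^{\mathrm{s}}$. Moreover $\Theta_{\phi^\lambda}$ is an isomorphism from $(\mathcal{T}(D_E^{\mathrm{s}},D_V^{\mathrm{s}}),\triangleleft)$ to $(\mathcal{T}(D_E^{\mathrm{s}},D_V^{\mathrm{s}}),\triangleleft^{\phi^\lambda})$, with inverse $\Theta_{\phi^{-\lambda}}$.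
   Context: $\mathbb{K}$ is a field of characteristic zero. Notation: $l\leq b$ and $\min$ are componentwise on $\mathbb{N}^{d+1}$, $\binom{b}{l}=\prod_i\binom{b_i}{l_i}$, $\lambda^l=\prod_i\lambda_i^{l_i}$ ($0^0=1$). For vector spaces $D_E,D_V$: rooted trees are finite non-planar, edges oriented from root to leaves with source $s(e)$ (endpoint nearer the root); $\mathcal{T}(D_E,D_V)=\bigoplus_T\bigl(\bigotimes_{e\in E(T)}D_E\otimes\bigotimes_{v\in V(T)}D_V\bigr)$, elements $T\otimes W_T$ with $W_T$ the tensor of edge and vertex decorations. For linear $\phi$ on $D_E\otimes D_V$, $\phi_{e,v}$ applies $\phi$ to the decorations of edge $e$ and vertex $v$. $\phi$ is tree-compatible if $\phi_{13}\phi_{23}=\phi_{23}\phi_{13}$ on $D_E\otimes D_E\otimes D_V$, where $\phi_{23}=\mathrm{Id}\otimes\phi$, $\phi_{13}=(\tau\otimes\mathrm{Id})(\mathrm{Id}\otimes\phi)(\tau\otimes\mathrm{Id})$ ($\tau$ flip). For tree-compatible $\phi$, $\Theta_\phi$ acts on $T\otimes W_T$ by applying the composite of all $\phi_{e,s(e)}$, $e\in E(T)$ (order irrelevant) to $W_T$. For $v\in V(T')$, $T\curvearrowright_vT'$ adds an edge from $v$ to the root of $T$; $(T\otimes W_T)\triangleleft^\phi_a(T'\otimes W_{T'})=\sum_{v\in V(T')}T\curvearrowright_vT'\otimes\phi_{e_{\mathrm{new}},v}(a\otimes W_T\otimes W_{T'})$ with $a$ decorating the new edge; $\triangleleft=\triangleleft^{\mathrm{Id}}$.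 A $D_E$-multiple pre-Lie algebra is a space with products $\triangleleft_a$ linear in $a\in D_E$ satisfying $x\triangleleft_a(y\triangleleft_{a'}z)-(x\triangleleft_a y)\triangleleft_{a'}z=y\triangleleft_{a'}(x\triangleleft_a z)-(y\triangleleft_{a'}x)\triangleleft_a z$. ''Freely generated by $\bullet\otimes b$'' means every linear map from $D_V$ to a $D_E$-multiple pre-Lie algebra extends uniquely to a morphism sending $\bullet\otimes b\mapsto f(b)$. *)

(* Defs.v *)
From HB Require Import structures.
From mathcomp Require Import all_boot all_order all_algebra.
From mathcomp Require Import finmap generic_quotient monalg.

Set Implicit Arguments.
Unset Strict Implicit.
Unset Printing Implicit Defensive.

Import GRing.Theory.
Local Open Scope ring_scope.
Local Open Scope quotient_scope.

(* Vect(X) is {malg K[X]}, with basis << x >>, x : X. Tensor products of such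
   spaces are taken in the form Vect(X) (x) Vect(Y) = Vect(X * Y), and
   Vect(X)^{(x) I} = Vect({ffun I -> X}) for a finite index set I. *)
Section LinearExtension.
Context {K : fieldType} {X : choiceType} {L : lmodType K}.

Definition lext (f : X -> L) (g : {malg K[X]}) : L :=
  \sum_(x <- msupp g) g@_x *: f x.

Lemma lextEw f g (D : {fset X}) : (msupp g `<=` D)%fset ->
  lext f g = \sum_(x <- D) g@_x *: f x.
Proof.
move=> sgD; rewrite /lext; apply/big_fset_incl => // x _ /mcoeff_outdom ->.
by rewrite scale0r.
Qed.

Lemma lext_is_linear f : linear (lext f).
Proof.
move=> c g h; pose D := (msupp g `|` msupp h `|` msupp (c *: g + h))%fset.
have sg : (msupp g `<=` D)%fset by rewrite /D -fsetUA fsubsetUl.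
have sh : (msupp h `<=` D)%fset by rewrite /D fsetUAC fsubsetUr.
rewrite (lextEw f sg) (lextEw f sh) (@lextEw _ _ D) ?fsubsetUr //.
rewrite scaler_sumr -big_split /=; apply: eq_bigr => x _.
by rewrite mcoeffD mcoeffZ scalerDl scalerA.
Qed.

HB.instance Definition _ f :=
  GRing.isLinear.Build K {malg K[X]} L *:%R (lext f) (lext_is_linear f).

Lemma lextU f x : lext f << x >> = f x.
Proof. by rewrite (lextEw f msuppU_le) big_seq_fset1 mcoeffUU scale1r. Qed.

End LinearExtension.

(* A rooted tree with n edges is given on the vertex set {0, ..., n}, with root
   0, the endpoint of edge e farther from the root being e + 1 and the nearer
   one satisfying s(e) <= e. Every finite rooted tree has such a labelling of
   its vertices; the labelling is forgotten by [isom] below. *)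
Definition rtree : Type :=
  {n : nat & {s : {ffun 'I_n -> 'I_n.+1} | [forall e : 'I_n, s e <= e]%N}}.
HB.instance Definition _ := Choice.on rtree.

Definition edge (T : rtree) : finType := 'I_(tag T).
Definition vertex (T : rtree) : finType := 'I_(tag T).+1.
Definition src (T : rtree) (e : edge T) : vertex T := val (tagged T) e.
Definition tgt (T : rtree) (e : edge T) : vertex T := lift ord0 e.

Lemma src_le (T : rtree) (e : edge T) : (src e <= e)%N.
Proof. exact: (forallP (valP (tagged T)) e). Qed.

Fact one_vertex_subproof :
  [forall e : 'I_0, ([ffun=> ord0] : {ffun 'I_0 -> 'I_1}) e <= e]%N.
Proof. by apply/forallP; case. Qed.

Definition one_vertex : rtree :=
  Tagged (fun n => {s : {ffun 'I_n -> 'I_n.+1} | [forall e : 'I_n, s e <= e]%N})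
    (exist _ [ffun=> ord0] one_vertex_subproof).

(* The edges of the grafting of T on T' at v are those of T', then the new one,
   then those of T; its vertices are those of T', then those of T. *)
Section Graft.
Variables (T T' : rtree) (v : vertex T').
Let n := tag T.
Let n' := tag T'.

Definition graft_src : {ffun 'I_(n' + n.+1) -> 'I_(n' + n.+1).+1} :=
  [ffun e => match split e with
             | inl e' => lshift n.+1 (src (e' : edge T'))
             | inr f => match unlift ord0 f with
                        | None => lshift n.+1 v
                        | Some e' => rshift n'.+1 (src (e' : edge T))
                        end
             end].

Fact graft_subproof : [forall e : 'I_(n' + n.+1), graft_src e <= e]%N.
Proof.
apply/forallP => e; rewrite ffunE; case: splitP => [e' -> /=|f ->].
  exact: src_le.
case: unliftP => [e' ->|->] /=; last by rewrite addn0 -ltnS ltn_ord.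
rewrite addSn /bump leq0n add1n addnS ltnS leq_add2l.
exact: src_le.
Qed.

Definition graft : rtree :=
  Tagged (fun n => {s : {ffun 'I_n -> 'I_n.+1} | [forall e : 'I_n, s e <= e]%N})
    (exist _ graft_src graft_subproof).

Definition new_edge : edge graft := rshift n' ord0.

Definition host_vertex (u : vertex T') : vertex graft := lshift n.+1 u.

End Graft.

Section Trees.
Context (K : fieldType) (A B : choiceType).

Definition deco (T : rtree) : choiceType :=
  ({ffun edge T -> A} * {ffun vertex T -> B})%type.

Definition tensor (T : rtree) : lmodType K := {malg K[deco T]}.

Definition dtree : Type := {T : rtree & deco T}.
HB.instance Definition _ := Choice.on dtree.

Definition tree_of (x : dtree) : rtree := tag x.
Definition edge_deco (x : dtree) : {ffun edge (tree_of x) -> A} :=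
  (tagged x : deco (tree_of x)).1.
Definition vertex_deco (x : dtree) : {ffun vertex (tree_of x) -> B} :=
  (tagged x : deco (tree_of x)).2.

Definition isom_by (x y : dtree) (f : {ffun edge (tree_of x) -> edge (tree_of y)})
    (g : {ffun vertex (tree_of x) -> vertex (tree_of y)}) : bool :=
  [&& injectiveb f, injectiveb g,
      [forall e, (src (f e) == g (src e)) && (tgt (f e) == g (tgt e))],
      [forall e, edge_deco y (f e) == edge_deco x e] &
      [forall v, vertex_deco y (g v) == vertex_deco x v]].

Definition isom (x y : dtree) : bool :=
  (tag (tree_of x) == tag (tree_of y)) &&
  [exists f, exists g, @isom_by x y f g].

Lemma isomP x y : reflect
  (tag (tree_of x) = tag (tree_of y) /\
   exists f : edge (tree_of x) -> edge (tree_of y),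
   exists g : vertex (tree_of x) -> vertex (tree_of y),
   [/\ injective f, injective g,
       forall e, src (f e) = g (src e) /\ tgt (f e) = g (tgt e),
       forall e, edge_deco y (f e) = edge_deco x e &
       forall v, vertex_deco y (g v) = vertex_deco x v]) (isom x y).
Proof.
apply: (iffP andP) => [[/eqP En /existsP[f /existsP[g]]]|[En [f [g]]]].
  case/and5P => /injectiveP fI /injectiveP gI /forallP st /forallP ha /forallP hb.
  split=> //; exists f, g; split=> // e; last exact/eqP.
    by have /andP[/eqP ? /eqP ?] := st e.
  exact/eqP.
case=> fI gI st ha hb; split; first exact/eqP.
apply/existsP; exists [ffun e => f e]; apply/existsP; exists [ffun v => g v].
apply/and5P; split.
- by apply/injectiveP => e1 e2; rewrite !ffunE => /fI.
- by apply/injectiveP => e1 e2; rewrite !ffunE => /gI.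
- by apply/forallP => e; rewrite !ffunE; case: (st e) => -> ->; rewrite !eqxx.
- by apply/forallP => e; rewrite ffunE ha.
- by apply/forallP => e; rewrite ffunE hb.
Qed.

Lemma isom_refl : reflexive isom.
Proof. by move=> x; apply/isomP; split=> //; exists id, id; split. Qed.

Lemma isom_trans : transitive isom.
Proof.
move=> y x z /isomP[Exy [f [g [fI gI st ha hb]]]].
move=> /isomP[Eyz [f' [g' [fI' gI' st' ha' hb']]]].
apply/isomP; split; first by rewrite Exy.
exists (f' \o f), (g' \o g); split=> [||e|e|v] /=.
- exact: inj_comp.
- exact: inj_comp.
- by case: (st e) (st' (f e)) => <- <- [-> ->].
- by rewrite ha' ha.
- by rewrite hb' hb.
Qed.

Lemma isom_sym : symmetric isom.
Proof.
suff S x y : isom x y -> isom y x by move=> x y; apply/idP/idP; apply: S.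
move=> /isomP[Exy [f [g [fI gI st ha hb]]]].
have [f1 fK Kf] : bijective f by apply: inj_card_bij; rewrite // !card_ord Exy.
have [g1 gK Kg] : bijective g by apply: inj_card_bij; rewrite // !card_ord Exy.
apply/isomP; split=> //; exists f1, g1; split=> [||e|e|v].
- exact: can_inj Kf.
- exact: can_inj Kg.
- by have [] := st (f1 e); rewrite !Kf => -> ->; rewrite !gK.
- by rewrite -{2}(Kf e) ha.
- by rewrite -{2}(Kg v) hb.
Qed.

Canonical isom_equiv := EquivRel isom isom_refl isom_sym isom_trans.

(* Since D_E = Vect(A) and D_V = Vect(B), the isomorphism classes of decorated
   trees form a basis of T(D_E, D_V). The trees being non-planar, tensors that
   differ by an automorphism of the tree are identified. *)
Definition dtree_class : Type := {eq_quot isom}.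
HB.instance Definition _ := Choice.on dtree_class.
HB.instance Definition _ := EqQuotient.on dtree_class.

Definition TT : lmodType K := {malg K[dtree_class]}.

Definition tree_elt (T : rtree) : tensor T -> TT :=
  lext (fun w : deco T => << \pi_dtree_class (Tagged deco w) >>).

Definition bullet : {malg K[B]} -> TT :=
  lext (fun b : B => @tree_elt one_vertex
    << ((ffun0 (card_ord 0), [ffun=> b]) : deco one_vertex) >>).

Implicit Type phi : {linear {malg K[(A * B)%type]} -> {malg K[(A * B)%type]}}.

Definition phi23 phi : {malg K[(A * A * B)%type]} -> {malg K[(A * A * B)%type]} :=
  lext (fun x : A * A * B =>
    lext (fun y : A * B => << (x.1.1, y.1, y.2) >>) (phi << (x.1.2, x.2) >>)).

Definition flip12 : {malg K[(A * A * B)%type]} -> {malg K[(A * A * B)%type]} :=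
  lext (fun x : A * A * B => << (x.1.2, x.1.1, x.2) >>).

Definition phi13 phi := flip12 \o phi23 phi \o flip12.

Definition tree_compatible phi : Prop :=
  phi13 phi \o phi23 phi =1 phi23 phi \o phi13 phi.

Definition redecorate (T : rtree) (e : edge T) (v : vertex T) (w : deco T)
    (p : A * B) : deco T :=
  ([ffun f => if f == e then p.1 else w.1 f],
   [ffun u => if u == v then p.2 else w.2 u]).

Definition phi_at phi (T : rtree) (e : edge T) (v : vertex T) :
    tensor T -> tensor T :=
  lext (fun w : deco T =>
    lext (fun p : A * B => << redecorate e v w p >>) (phi << (w.1 e, w.2 v) >>)).

Definition Theta_tensor phi (T : rtree) : tensor T -> tensor T :=
  \big[(fun f g => f \o g)/id]_(e : edge T) phi_at phi e (src e).

(* On an isomorphism class of decorated trees, [Theta] and [tri] are computed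
   on a chosen representative; the result does not depend on the choice (for
   [Theta], because phi is tree-compatible). *)
Definition Theta phi : TT -> TT :=
  lext (fun t : dtree_class =>
    let x : dtree := repr t in tree_elt (Theta_tensor phi << tagged x >>)).

Definition join_deco (T T' : rtree) (v : vertex T') (a : A)
    (w : deco T) (w' : deco T') : deco (graft T v) :=
  ([ffun e : 'I_(tag T' + (tag T).+1) =>
      match split e with
      | inl e' => w'.1 e'
      | inr f => if unlift ord0 f is Some e' then w.1 e' else a
      end],
   [ffun u : 'I_((tag T').+1 + (tag T).+1) =>
      match split u with inl u' => w'.2 u' | inr u' => w.2 u' end]).

Definition join_tensor (T T' : rtree) (v : vertex T') (a : {malg K[A]})
    (W : tensor T) (W' : tensor T') : tensor (graft T v) :=
  lext (fun i : A =>
    lext (fun w : deco T =>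
      lext (fun w' : deco T' => << join_deco v i w w' >>) W') W) a.

Definition tri phi (a : {malg K[A]}) (x y : TT) : TT :=
  lext (fun t : dtree_class =>
    lext (fun t' : dtree_class =>
      let s : dtree := repr t in let s' : dtree := repr t' in
      \sum_(v : vertex (tree_of s'))
        tree_elt (phi_at phi (new_edge (tree_of s) v)
          (host_vertex (tree_of s) v v)
          (join_tensor v a << tagged s >> << tagged s' >>))) y) x.

End Trees.

Section MultiplePreLie.
Context (K : fieldType) (E : lmodType K).

Definition multiple_prelie (L : lmodType K) (m : E -> L -> L -> L) : Prop :=
  [/\ forall x y, linear (fun a => m a x y),
      forall a y, linear (fun x => m a x y),
      forall a x, linear (m a x) &
      forall a a' x y z,
        m a x (m a' y z) - m a' (m a x y) z
          = m a' y (m a x z) - m a (m a' y x) z].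

Definition mpl_morphism (L L' : lmodType K) (m : E -> L -> L -> L)
    (m' : E -> L' -> L' -> L') (F : L -> L') : Prop :=
  linear F /\ forall a x y, F (m a x y) = m' a (F x) (F y).

Definition mpl_isomorphism (L L' : lmodType K) (m : E -> L -> L -> L)
    (m' : E -> L' -> L' -> L') (F : L -> L') : Prop :=
  mpl_morphism m m' F /\ bijective F.

Definition freely_generated (V L : lmodType K) (m : E -> L -> L -> L)
    (i : V -> L) : Prop :=
  multiple_prelie m /\
  forall (L' : lmodType K) (m' : E -> L' -> L' -> L') (f : {linear V -> L'}),
    multiple_prelie m' ->
    exists2 F : L -> L', mpl_morphism m m' F /\ (forall b, F (i b) = f b) &
      forall G : L -> L', mpl_morphism m m' G -> (forall b, G (i b) = f b) ->
        G =1 F.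

End MultiplePreLie.

From mathcomp Require Import mpoly.

Definition multiindex (d : nat) : choiceType := 'X_{1..d.+1}.

Definition D_s (K : fieldType) (d : nat) : lmodType K := {malg K[multiindex d]}.

(* The sum runs over all l <= min(a, b), since l <= b bounds the degree of l. *)
Definition phi_lambda (K : fieldType) (d : nat) (lam : 'rV[K]_d.+1) :
    {linear {malg K[(multiindex d * multiindex d)%type]} ->
            {malg K[(multiindex d * multiindex d)%type]}} :=
  lext (fun ab : multiindex d * multiindex d =>
    let: (a, b) := (ab : 'X_{1..d.+1} * 'X_{1..d.+1}) in
    \sum_(l : 'X_{1..d.+1 < (mdeg b).+1} |
            [forall i, bmnm l i <= minn (a i) (b i)]%N)
      ((\prod_i lam 0 i ^+ bmnm l i) * (\prod_i 'C(b i, bmnm l i))%N%:R)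
        *: << (((a - l)%MM, (b - l)%MM) : multiindex d * multiindex d) >>).

(* Main.v *)
(** Since all the phi_(e, s(e)) commute, grafting one tree on another and then
    applying Theta amounts to applying Theta to both trees, grafting, and
    finally applying phi to the new edge and its source: so Theta intertwines
    the two products.  Since phi^(-lambda) inverts
    phi^lambda by the binomial theorem, Theta is an isomorphism, and freeness
    needs to be proved only for the undeformed product.

    For existence, the value of a decorated tree in a multiple pre-Lie algebra
    is computed from the leaves to the root: the value at a vertex is the
    symmetric brace (Guin and Oudom) of the values at its children.  Summing
    over the grafting points in the subtree below a vertex u, the recursion defining
    the brace makes all terms telescope to the product with the value at u.
    For uniqueness, every tree with an edge is a grafting on the root, and the
    other terms of the corresponding product have a root of smaller degree. *)

From HB Require Import structures.
From mathcomp Require Import all_boot all_order all_algebra.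
From mathcomp Require Import finmap generic_quotient monalg.
Require Import Defs.

Set Implicit Arguments.
Unset Strict Implicit.
Unset Printing Implicit Defensive.

Import GRing.Theory.
Local Open Scope ring_scope.
Local Open Scope quotient_scope.

(** * Linear functions and symmetric braces *)

(** Non-planarity shapes the argument. Elements of [TT] are handled through labelled
    representatives, and an isomorphism may permute the edges leaving a vertex; the value of a tree
    is therefore well defined only if the brace does not depend on the order of its entries. It is
    for this symmetry that the pre-Lie identity of the target algebra is used. The brace itself is
    forced: a product with a brace has to be the sum of the graftings on its base and on each of its
    entries, and solving for the first of these terms gives the recursion on the list of entries.
    Both properties of phi^lambda come, one coordinate at a time, from C(b, j) C(b - j, k) = C(b, j
    + k) C(j + k, j). The right side is symmetric in j and k, whence the commutation of two
    operators at a vertex; summed over all j + k = s with weights c^j and (-c)^k it gives C(b, s) (c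
    - c)^s, whence the inverse. *)

Section LinearFunctions.
Context {K : fieldType}.
Implicit Types U V W : lmodType K.

Lemma linear_sub U V (f g : U -> V) :
  linear f -> linear g -> linear (fun x => f x - g x).
Proof. by move=> lf lg a x y; rewrite lf lg scalerBr opprD addrACA. Qed.

Lemma linear_compose U V W (f : V -> W) (g : U -> V) :
  linear f -> linear g -> linear (fun x => f (g x)).
Proof. by move=> lf lg a x y; rewrite lg lf. Qed.

Lemma linear_big U V (I : eqType) (r : seq I) (F : I -> U -> V) :
  (forall i, i \in r -> linear (F i)) -> linear (fun x => \sum_(i <- r) F i x).
Proof.
move=> lF a x y; rewrite scaler_sumr -big_split !big_seq.
by apply: eq_bigr => i /lF ->.
Qed.

Lemma linear_ext U V (f g : U -> V) : f =1 g -> linear f -> linear g.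
Proof. by move=> fg lf a x y; rewrite -!fg lf. Qed.

Lemma linear_eq0 U V (f : U -> V) : linear f -> f 0 = 0.
Proof. by move=> lf; have := lf (-1) 0 0; rewrite scaler0 addr0 scaleN1r addNr. Qed.

Lemma linear_scale U V (f : U -> V) c x : linear f -> f (c *: x) = c *: f x.
Proof. by move=> lf; have := lf c x 0; rewrite (linear_eq0 lf) !addr0. Qed.

Lemma linear_sumE U V (f : U -> V) (I : Type) (r : seq I) (P : pred I) (F : I -> U) :
  linear f -> f (\sum_(i <- r | P i) F i) = \sum_(i <- r | P i) f (F i).
Proof.
move=> lf; apply: (big_morph f _ (linear_eq0 lf)) => x y.
by rewrite -[x]scale1r lf !scale1r.
Qed.

Lemma sum_swap V (I J : finType) (F : I -> J -> V) (G : J -> I -> V) :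
  (forall i j, F i j = G j i) -> \sum_i \sum_j F i j = \sum_j \sum_i G j i.
Proof.
by move=> FG; rewrite exchange_big; apply: eq_bigr => j _; apply: eq_bigr => i _.
Qed.

Lemma linear_id U : linear (@id U).
Proof. by []. Qed.

Lemma malg_eq_linear (X : choiceType) V (f g : {malg K[X]} -> V) :
  linear f -> linear g -> (forall x, f << x >> = g << x >>) -> f =1 g.
Proof.
move=> lf lg fg x; rewrite [x]monalgE !linear_sumE //; apply: eq_bigr => i _.
have -> : << x@_i *g i >> = x@_i *: << i >> :> {malg K[X]}.
  by apply/malgP => k; rewrite mcoeffZ !mcoeffU mulr_natr.
by rewrite !linear_scale ?fg.
Qed.

Lemma lext_linearl (X : choiceType) U V (F : U -> X -> V) (g : {malg K[X]}) :
  (forall x, linear (fun u => F u x)) -> linear (fun u => lext (F u) g).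
Proof.
by move=> lF; apply: linear_big => i _ a u v; rewrite lF scalerDr !scalerA mulrC.
Qed.

Lemma eq_lext (X : choiceType) V (f g : X -> V) : f =1 g -> lext f =1 lext g.
Proof. by move=> fg x; apply: eq_bigr => i _; rewrite fg. Qed.

End LinearFunctions.

Definition upd (I : eqType) (L : Type) (c : I -> L) (j : I) (x : L) : I -> L :=
  fun k => if k == j then x else c k.

(* The symmetric brace of a pre-Lie algebra (Guin and Oudom): the entries c i,
   attached along edges decorated by al i, are grafted simultaneously on b. *)
Section Brace.
Context {K : fieldType} {E L : lmodType K} (m : E -> L -> L -> L).

Fixpoint brace (I : eqType) (al : I -> E) (b : L) (s : seq I) (c : I -> L) : L :=
  if s is i :: s' then
    m (al i) (c i) (brace al b s' c)
      - \sum_(j <- s') brace al b s' (upd c j (m (al i) (c i) (c j)))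
  else b.

(** Nothing outside [s] is ever read. Updates can leave stale values at indices already consumed,
    and this lemma discards them. *)
Lemma eq_brace (I : eqType) (al al' : I -> E) b s c c' :
  {in s, al =1 al'} -> {in s, c =1 c'} -> brace al b s c = brace al' b s c'.
Proof.
elim: s c c' => //= i s IHs c c' eal ec.
have eal' : {in s, al =1 al'} by move=> j js; rewrite eal // inE js orbT.
have ec' : {in s, c =1 c'} by move=> j js; rewrite ec // inE js orbT.
rewrite eal ?ec ?mem_head // (IHs c c' eal' ec'); congr (_ - _).
rewrite !big_seq; apply: eq_bigr => j js; apply: IHs => // k ks.
rewrite /upd (ec' j js); case: ifP => // _; exact: ec'.
Qed.

Lemma brace_map (I J : eqType) (h : I -> J) (al : J -> E) b s c :
  injective h -> brace al b (map h s) c = brace (al \o h) b s (c \o h).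
Proof.
move=> hI; elim: s c => //= i s IHs c; rewrite IHs big_map; congr (_ - _).
apply: eq_bigr => j _; rewrite IHs; apply: eq_brace => // k _.
by rewrite /upd /= (inj_eq hI).
Qed.

Hypothesis hm : multiple_prelie m.

(** Each term reads the entry at [j] exactly once. If [j] is the head, it is the left argument of a
    product; if [j] is in the tail, induction applies, the summand indexed by [j] wrapping the entry
    in one more product. This is what lets a sum over grafting points leave an entry. *)
Lemma brace_linear (I : eqType) (al : I -> E) b s c j : uniq s -> j \in s ->
  linear (fun x => brace al b s (upd c j x)).
Proof.
case: hm => _ lx ly _; elim: s c j => //= i s IHs c j /andP[nis us].
have neq k : k \in s -> (k == i) = false.
  by move=> ks; apply: contraNF nis => /eqP <-.
rewrite inE; have [-> _|nji /= js] := eqVneq j i.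
  apply: (@linear_ext _ _ _ (fun x => m (al i) x (brace al b s c)
    - \sum_(k <- s) brace al b s (upd c k (m (al i) x (c k))))).
    move=> x; congr (_ - _); first congr (m _ _ _).
    - by rewrite /upd eqxx.
    - by apply: eq_brace => // k ks; rewrite /upd neq.
    - rewrite !big_seq; apply: eq_bigr => k ks; apply: eq_brace => // l ls.
      by rewrite /upd eqxx !neq.
  apply: linear_sub; first exact: lx.
  by apply: linear_big => k ks; apply: (linear_compose (IHs c k us ks)); apply: lx.
apply: (@linear_ext _ _ _ (fun x => m (al i) (c i) (brace al b s (upd c j x))
  - \sum_(k <- s) if k == j then brace al b s (upd c j (m (al i) (c i) x))
     else brace al b s (upd (upd c k (m (al i) (c i) (c k))) j x))).
  move=> x; have ->: upd c j x i = c i by rewrite /upd eq_sym (negPf nji).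
  congr (_ - _); apply: eq_bigr => k _; case: eqP => [->|/eqP nkj].
    by apply: eq_brace => // l _; rewrite /upd eqxx; case: eqP.
  apply: eq_brace => // l _; rewrite /upd (negPf nkj).
  by case: (eqVneq l j) => // ->; rewrite eq_sym (negPf nkj).
apply: linear_sub; first by apply: (linear_compose (ly _ _)); apply: IHs.
apply: linear_big => k ks; case: eqP => _; last exact: IHs.
by apply: (linear_compose (IHs c j us js)); apply: ly.
Qed.

(** Unfolding both entries gives terms that regroup into pieces, each symmetric in the two. The
    pre-Lie identity serves twice: on the brace of the remaining entries, and on each remaining
    entry [c k]. *)
Lemma brace_swap (I : eqType) (al : I -> E) b i j s c : uniq [:: i, j & s] ->
  brace al b [:: i, j & s] c = brace al b [:: j, i & s] c.
Proof.
case: hm => _ lx ly pl.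
move=> /andP[]; rewrite inE negb_or => /andP[nij nis] /andP[njs us].
have S c1 c2 : {in s, c1 =1 c2} -> brace al b s c1 = brace al b s c2.
  by move=> h; apply: eq_brace.
have nE k l : l \notin s -> k \in s -> (k == l) = false /\ (l == k) = false.
  by move=> ls ks; split; apply: contraNF ls => /eqP; [move<-|move->].
pose U k x := brace al b s (upd c k x).
(* [D] collects the terms where the two entries are grafted on two different remaining entries; its
   symmetry is an exchange of sums. *)
pose D i j := \sum_(k <- s) \sum_(l <- s | l != k)
   brace al b s (upd (upd c k (m (al i) (c i) (c k))) l (m (al j) (c j) (c l))).
have DC p q : D p q = D q p.
  rewrite /D (exchange_big_dep predT) //=; apply: eq_bigr => k _.
  apply: eq_big => [l|l nkl]; first by rewrite eq_sym.
  apply: S => o _; rewrite /upd; case: (eqVneq o k) => // ->.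
  by rewrite (negPf nkl).
pose B := brace al b s c.
have rearrange (x0 s1 y0 z1 s2 z2 d : L) :
  x0 - s1 - (y0 - z1 + (s2 - (z2 + d))) = x0 - y0 - (s1 + s2) + (z1 + z2 + d).
  by rewrite !opprD !opprK !addrA [LHS](ACl (1*3*2*5*4*6*7)).
(* The first group is one side of the pre-Lie identity at [B]; in the second, one entry goes on the
   whole and the other on some [c k]; in the third, both go on the same [c k], or on two different
   ones ([D]). *)
have step p q : p != q -> p \notin s -> q \notin s ->
  brace al b [:: p, q & s] c =
    (m (al p) (c p) (m (al q) (c q) B) - m (al q) (m (al p) (c p) (c q)) B)
    - (\sum_(k <- s) m (al p) (c p) (U k (m (al q) (c q) (c k)))
       + \sum_(k <- s) m (al q) (c q) (U k (m (al p) (c p) (c k))))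
    + (\sum_(k <- s) U k (m (al q) (m (al p) (c p) (c q)) (c k)
        + m (al q) (c q) (m (al p) (c p) (c k))) + D p q).
  move=> npq nps nqs /=; rewrite big_cons /=.
  have mB x y z u : m u x (y - z) = m u x y - m u x z.
    by rewrite -[y - z]addrC -scaleN1r ly scaleN1r addrC.
  have uu x : upd c q x q = x by rewrite /upd eqxx.
  rewrite mB linear_sumE // !uu.
  have -> : brace al b s (upd c q (m (al p) (c p) (c q))) = B.
    by apply: S => k /(nE _ _ nqs)[kq _]; rewrite /upd kq.
  have -> : \sum_(k <- s) brace al b s (upd (upd c q (m (al p) (c p) (c q))) k
      (m (al q) (m (al p) (c p) (c q)) (upd c q (m (al p) (c p) (c q)) k)))
    = \sum_(k <- s) U k (m (al q) (m (al p) (c p) (c q)) (c k)).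
    rewrite !big_seq; apply: eq_bigr => k ks; apply: S => l ls.
    by rewrite /upd; case: eqP => // _; [have [-> _] := nE _ _ nqs ks|have [-> _] := nE _ _ nqs ls].
  have -> : \sum_(k <- s) (m (al q) (upd c k (m (al p) (c p) (c k)) q)
       (brace al b s (upd c k (m (al p) (c p) (c k)))) -
     \sum_(l <- s) brace al b s (upd (upd c k (m (al p) (c p) (c k))) l
        (m (al q) (upd c k (m (al p) (c p) (c k)) q) (upd c k (m (al p) (c p) (c k)) l))))
   = \sum_(k <- s) m (al q) (c q) (U k (m (al p) (c p) (c k)))
     - (\sum_(k <- s) U k (m (al q) (c q) (m (al p) (c p) (c k))) + D p q).
    rewrite /D -big_split -sumrB !big_seq; apply: eq_bigr => k ks /=.
    have qk : upd c k (m (al p) (c p) (c k)) q = c q.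
      by rewrite /upd; have [_ ->] := nE _ _ nqs ks.
    (* The summand [l = k], where both entries land on [c k], is what separates the inner sum from
       [D]. *)
    rewrite qk (bigD1_seq k) //=; congr (_ - (_ + _)).
      by apply: S => l _; rewrite /upd eqxx; case: eqP.
    by apply: eq_bigr => l nlk; rewrite {3}/upd (negPf nlk).
  have -> : \sum_(k <- s) U k (m (al q) (m (al p) (c p) (c q)) (c k)
        + m (al q) (c q) (m (al p) (c p) (c k)))
    = \sum_(k <- s) U k (m (al q) (m (al p) (c p) (c q)) (c k))
      + \sum_(k <- s) U k (m (al q) (c q) (m (al p) (c p) (c k))).
    rewrite -big_split !big_seq; apply: eq_bigr => k ks /=.
    have := brace_linear al b c us ks 1 (m (al q) (m (al p) (c p) (c q)) (c k))
      (m (al q) (c q) (m (al p) (c p) (c k))).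
    by rewrite !scale1r.
  exact: rearrange.
have nji : j != i by rewrite eq_sym.
rewrite !step // DC pl; congr (_ - _ + (_ + _)); first by rewrite addrC.
apply: eq_bigr => k _; congr (U k _).
(* The pre-Lie identity is needed without subtraction, so its two negative terms are moved
   across. *)
have /(congr1 (fun x => x + m (al j) (m (al i) (c i) (c j)) (c k)
   + m (al i) (m (al j) (c j) (c i)) (c k))) := pl (al i) (al j) (c i) (c j) (c k).
by rewrite subrK addrAC subrK => e; rewrite addrC -e addrC.
Qed.

(** Adjacent transpositions suffice: the head of [s] is located in [s'] and carried to the front
    past one entry at a time. *)
Lemma perm_brace (I : eqType) (al : I -> E) b s s' c : uniq s -> perm_eq s s' ->
  brace al b s c = brace al b s' c.
Proof.
(* The tails must agree for every [c], since the recursion evaluates them at updated entries. *)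
have skip i t t' : (forall c, brace al b t c = brace al b t' c) -> perm_eq t t' ->
    forall c, brace al b (i :: t) c = brace al b (i :: t') c.
  move=> e p d /=; rewrite e (perm_big _ p) /=; congr (_ - _).
  by apply: eq_bigr => j _; rewrite e.
elim: s s' c => [|i s IHs] s' c; first by move=> _; rewrite perm_sym => /perm_nilP ->.
move=> /[dup] uis /andP[nis us] ps.
have us' : uniq s' by rewrite -(perm_uniq ps).
have is' : i \in s' by rewrite -(perm_mem ps) mem_head.
case/splitPr: s' / is' ps us' => s1 s2.
rewrite -cat_rcons perm_sym -cats1 perm_catAC perm_sym => ps us'.
have {ps} ps : perm_eq s (s1 ++ s2).
  by move: ps; rewrite perm_sym perm_catC /= perm_cons perm_sym.
rewrite (skip i s (s1 ++ s2)) //; last by move=> d; apply: IHs.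
elim: s1 us' c {ps} => // k s1 IHk /andP[nk us'] c.
have e d : brace al b (i :: s1 ++ s2) d = brace al b ((s1 ++ [:: i]) ++ s2) d.
  exact: IHk.
rewrite !cat_cons -(skip _ _ _ e); last by rewrite perm_sym -[_ :: _]/([:: i] ++ _) -catA perm_catCA.
apply: brace_swap; rewrite -(@perm_uniq _ (((k :: s1) ++ [:: i]) ++ s2)).
  by apply/andP.
rewrite perm_sym -[[:: i, k & _]]/([:: i] ++ (k :: s1) ++ s2).
by rewrite perm_catCA catA.
Qed.
End Brace.

(** * Grafting and isomorphisms of rooted trees *)

Lemma split_lshift m n (i : 'I_m) : split (lshift n i) = inl i.
Proof. exact: (unsplitK (inl i)). Qed.

Lemma split_rshift m n (i : 'I_n) : split (rshift m i) = inr i.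
Proof. exact: (unsplitK (inr i)). Qed.

Section GraftCases.
Variables (T T' : rtree) (v : vertex T').

Definition host_edge (e : edge T') : edge (graft T v) := lshift (tag T).+1 e.
(** The host is the tree grafted upon, the guest the tree being grafted. The [lift] skips position 0
    of the second block, reserved for the new edge. *)
Definition guest_edge (e : edge T) : edge (graft T v) :=
  rshift (tag T') (lift ord0 e).
Definition guest_vertex (u : vertex T) : vertex (graft T v) :=
  rshift (tag T').+1 u.

Definition edge_case R (h : edge T' -> R) (r : R) (k : edge T -> R)
    (e : edge (graft T v)) : R :=
  match split (e : 'I_(tag T' + (tag T).+1)) with
  | inl e' => h e'
  | inr f => if unlift ord0 f is Some e' then k e' else r
  end.

Definition vertex_case R (h : vertex T' -> R) (k : vertex T -> R)
    (u : vertex (graft T v)) : R :=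
  match split (u : 'I_((tag T').+1 + (tag T).+1)) with
  | inl u' => h u'
  | inr u' => k u'
  end.

Lemma edge_caseH R h (r : R) k e : edge_case h r k (host_edge e) = h e.
Proof. by rewrite /edge_case /host_edge split_lshift. Qed.

Lemma edge_caseN R h (r : R) k : edge_case h r k (new_edge T v) = r.
Proof. by rewrite /edge_case /new_edge split_rshift unlift_none. Qed.

Lemma edge_caseG R h (r : R) k e : edge_case h r k (guest_edge e) = k e.
Proof. by rewrite /edge_case /guest_edge split_rshift liftK. Qed.

Lemma vertex_caseH R (h : _ -> R) k u : vertex_case h k (host_vertex T v u) = h u.
Proof. by rewrite /vertex_case /host_vertex split_lshift. Qed.

Lemma vertex_caseG R (h : _ -> R) k u : vertex_case h k (guest_vertex u) = k u.
Proof. by rewrite /vertex_case /guest_vertex split_rshift. Qed.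

Definition case_graft :=
  (edge_caseH, edge_caseN, edge_caseG, vertex_caseH, vertex_caseG).

Variant edge_spec : edge (graft T v) -> Type :=
  | HostEdge e : edge_spec (host_edge e)
  | NewEdge : edge_spec (new_edge T v)
  | GuestEdge e : edge_spec (guest_edge e).

Lemma edgeP e : edge_spec e.
Proof.
pose e' : 'I_(tag T' + (tag T).+1) := e.
rewrite -[e]/e' -(splitK e'); case: (split e') => [f|f]; first exact: HostEdge.
by case: (unliftP ord0 f) => [f'|] -> /=; [apply: GuestEdge|apply: NewEdge].
Qed.

Variant vertex_spec : vertex (graft T v) -> Type :=
  | HostVertex u : vertex_spec (host_vertex T v u)
  | GuestVertex u : vertex_spec (guest_vertex u).

Lemma vertexP u : vertex_spec u.
Proof.
pose u' : 'I_((tag T').+1 + (tag T).+1) := u.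
rewrite -[u]/u' -(splitK u'); case: (split u') => f /=; first exact: HostVertex.
exact: GuestVertex.
Qed.

Lemma src_host e : src (host_edge e) = host_vertex T v (src e).
Proof. by rewrite {1}/src /= ffunE split_lshift. Qed.

Lemma src_new : src (new_edge T v) = host_vertex T v v.
Proof. by rewrite {1}/src /= ffunE split_rshift unlift_none. Qed.

Lemma src_guest e : src (guest_edge e) = guest_vertex (src e).
Proof. by rewrite {1}/src /= ffunE split_rshift liftK. Qed.

Lemma tgt_host e : tgt (host_edge e) = host_vertex T v (tgt e).
Proof. exact: val_inj. Qed.

Lemma tgt_new : tgt (new_edge T v) = guest_vertex ord0.
Proof. by apply: val_inj; rewrite /= /bump leq0n add1n !addn0. Qed.

Lemma tgt_guest e : tgt (guest_edge e) = guest_vertex (tgt e).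
Proof. by apply: val_inj; rewrite /= /bump !leq0n !add1n addSn. Qed.

Definition graftE :=
  (src_host, src_new, src_guest, tgt_host, tgt_new, tgt_guest).

Lemma host_root : host_vertex T v ord0 = ord0.
Proof. exact: val_inj. Qed.

Lemma host_edge_inj : injective host_edge.
Proof. exact: lshift_inj. Qed.

Lemma guest_edge_inj : injective guest_edge.
Proof. by move=> e e' /rshift_inj /lift_inj. Qed.

Lemma guest_vertex_inj : injective guest_vertex.
Proof. exact: (@rshift_inj (tag T').+1 (tag T).+1). Qed.

Lemma eq_edgeHH e e' : (host_edge e == host_edge e') = (e == e').
Proof. exact: eq_lshift. Qed.

Lemma eq_edgeHN e : (host_edge e == new_edge T v) = false.
Proof. exact: eq_lrshift. Qed.

Lemma eq_edgeHG e e' : (host_edge e == guest_edge e') = false.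
Proof. exact: eq_lrshift. Qed.

Lemma eq_edgeNG e' : (new_edge T v == guest_edge e') = false.
Proof. by rewrite /new_edge /guest_edge eq_rshift; apply/negbTE/neq_lift. Qed.

Lemma eq_edgeGG e e' : (guest_edge e == guest_edge e') = (e == e').
Proof. by rewrite (inj_eq guest_edge_inj). Qed.

Lemma eq_vertexHH u u' : (host_vertex T v u == host_vertex T v u') = (u == u').
Proof. exact: eq_lshift. Qed.

Lemma eq_vertexHG u u' : (host_vertex T v u == guest_vertex u') = false.
Proof. exact: eq_lrshift. Qed.

Lemma eq_vertexGG u u' : (guest_vertex u == guest_vertex u') = (u == u').
Proof. by rewrite (inj_eq guest_vertex_inj). Qed.

Lemma eq_edgeNH e : (new_edge T v == host_edge e) = false.
Proof. by rewrite eq_sym eq_edgeHN. Qed.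

Lemma eq_edgeGH e e' : (guest_edge e' == host_edge e) = false.
Proof. by rewrite eq_sym eq_edgeHG. Qed.

Lemma eq_edgeGN e' : (guest_edge e' == new_edge T v) = false.
Proof. by rewrite eq_sym eq_edgeNG. Qed.

Lemma eq_vertexGH u u' : (guest_vertex u' == host_vertex T v u) = false.
Proof. by rewrite eq_sym eq_vertexHG. Qed.

Definition graft_eqE := (eq_edgeHH, eq_edgeHN, eq_edgeHG, eq_edgeNH, eq_edgeNG,
  eq_edgeGH, eq_edgeGN, eq_edgeGG,
  eq_vertexHH, eq_vertexHG, eq_vertexGH, eq_vertexGG).

Lemma big_vertex_graft (R : Type) (idx : R) (op : Monoid.law idx)
    (F : vertex (graft T v) -> R) :
  \big[op/idx]_u F u = op (\big[op/idx]_u F (host_vertex T v u))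
    (\big[op/idx]_u F (guest_vertex u)).
Proof. exact: (@big_split_ord _ _ _ (tag T').+1 (tag T).+1). Qed.


End GraftCases.

(** Decorations are left out so that one pair of maps serves all of them through [relabel]. Equal
    sizes turn the two injections into bijections. *)
Record tree_iso (T T' : rtree) (f : edge T -> edge T') (g : vertex T -> vertex T') :
    Prop := TreeIso {
  iso_size : tag T = tag T';
  iso_edge_inj : injective f;
  iso_vertex_inj : injective g;
  iso_src : forall e, src (f e) = g (src e);
  iso_tgt : forall e, tgt (f e) = g (tgt e) }.

Section TreeIso.
Implicit Types S T X Y Z : rtree.

Lemma iso_vertex_surj T T' f g : @tree_iso T T' f g -> forall u, exists v, g v = u.
Proof.
case=> En _ gI _ _ u.
have : u \in codom g by apply: inj_card_onto; rewrite // !card_ord En.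
by case/codomP => v ->; exists v.
Qed.

(** Every other vertex is the target of an edge, and [g] sends targets to targets, which are never
    the root. *)
Lemma iso_root T T' f g : @tree_iso T T' f g -> g ord0 = ord0.
Proof.
move=> i; have [v gv] := iso_vertex_surj i ord0.
case: (unliftP ord0 v) gv => [e ->|-> //].
by rewrite -[lift _ _]/(tgt e) -(iso_tgt i).
Qed.

Lemma tree_iso_can T T' f g f' g' : tag T = tag T' -> cancel f f' -> cancel g g' ->
  (forall e, src (f e) = g (src e) /\ tgt (f e) = g (tgt e)) -> @tree_iso T T' f g.
Proof.
by move=> En fK gK st; split=> // [||e|e]; [apply: can_inj fK|apply: can_inj gK|..];
  have [] := st e.
Qed.

Lemma tree_iso_comp S T X f g f' g' : @tree_iso S T f g -> @tree_iso T X f' g' ->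
  tree_iso (f' \o f) (g' \o g).
Proof.
move=> i i'; split=> [||||e] /=.
- by rewrite (iso_size i) (iso_size i').
- exact: inj_comp (iso_edge_inj i') (iso_edge_inj i).
- exact: inj_comp (iso_vertex_inj i') (iso_vertex_inj i).
- by move=> e /=; rewrite (iso_src i') (iso_src i).
- by rewrite (iso_tgt i') (iso_tgt i).
Qed.

Lemma tree_iso_inv T T' f g : @tree_iso T T' f g ->
  exists f' g', [/\ @tree_iso T' T f' g', cancel f' f & cancel g' g].
Proof.
case=> En fI gI sr tg.
have [f' fK f'K] : bijective f by apply: inj_card_bij; rewrite // !card_ord En.
have [g' gK g'K] : bijective g by apply: inj_card_bij; rewrite // !card_ord En.
exists f', g'; split=> //; apply: (tree_iso_can _ f'K g'K) => // e.
by split; [rewrite -{2}[e]f'K sr gK|rewrite -{2}[e]f'K tg gK].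
Qed.

Lemma graft_iso S S' T T' f g f' g' (v : vertex S') :
  @tree_iso S T f g -> @tree_iso S' T' f' g' ->
  @tree_iso (graft S v) (graft T (g' v))
    (edge_case (fun e => host_edge T (g' v) (f' e)) (new_edge T (g' v))
       (fun e => guest_edge (g' v) (f e)))
    (vertex_case (fun u => host_vertex T (g' v) (g' u))
       (fun u => guest_vertex (g' v) (g u))).
Proof.
move=> i i'; split.
- by rewrite /= (iso_size i) (iso_size i').
- move=> e1 e2; case: (edgeP e1) => [x1||x1]; case: (edgeP e2) => [x2||x2];
    rewrite !case_graft => // /eqP; rewrite !graft_eqE // => /eqP.
    by move/(iso_edge_inj i') ->.
  by move/(iso_edge_inj i) ->.
- move=> e1 e2; case: (vertexP e1) => x1; case: (vertexP e2) => x2;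
    rewrite !case_graft => // /eqP; rewrite !graft_eqE // => /eqP.
    by move/(iso_vertex_inj i') ->.
  by move/(iso_vertex_inj i) ->.
- move=> e; case: (edgeP e) => [x||x]; rewrite !(case_graft, graftE) //.
    by rewrite (iso_src i').
  by rewrite (iso_src i).
- move=> e; case: (edgeP e) => [x||x]; rewrite !(case_graft, graftE) //.
  + by rewrite (iso_tgt i').
  + by rewrite (iso_root i).
  by rewrite (iso_tgt i).
Qed.

Definition graft_guest_edge X Y Z v u :
    edge (graft X (guest_vertex (T := Y) (T' := Z) v u)) ->
    edge (graft (graft X u) v) :=
  edge_case
    (edge_case (host_edge _ v) (new_edge _ v) (fun e => guest_edge v (host_edge X u e)))
    (guest_edge v (new_edge X u))
    (fun e => guest_edge v (guest_edge u e)).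

Definition graft_guest_vertex X Y Z v u :
    vertex (graft X (guest_vertex (T := Y) (T' := Z) v u)) ->
    vertex (graft (graft X u) v) :=
  vertex_case
    (vertex_case (host_vertex _ v) (fun y => guest_vertex v (host_vertex X u y)))
    (fun x => guest_vertex v (guest_vertex u x)).

(** Grafting [X] on a guest vertex, after [Y] was grafted on [Z], is the same as grafting [X] on [Y]
    first; only the numbering of the blocks differs. These are the terms that cancel in the
    associator. *)
Lemma graft_guest_iso X Y Z v u :
  tree_iso (@graft_guest_edge X Y Z v u) (@graft_guest_vertex X Y Z v u).
Proof.
apply: (@tree_iso_can _ _ _ _
  (edge_case (fun e => host_edge X _ (host_edge Y v e)) (host_edge X _ (new_edge Y v))
    (edge_case (fun e => host_edge X _ (guest_edge v e)) (new_edge X _)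
       (fun e => guest_edge _ e)))
  (vertex_case (fun e => host_vertex X _ (host_vertex Y v e))
    (vertex_case (fun e => host_vertex X _ (guest_vertex v e))
       (fun e => guest_vertex _ e)))).
- by rewrite /= -addnA addSn addnS.
- rewrite /graft_guest_edge => e; case: (edgeP e) => [{}e||{}e]; rewrite ?case_graft //.
  by case: (edgeP e) => [{}e||{}e]; rewrite !case_graft.
- rewrite /graft_guest_vertex => e; case: (vertexP e) => [{}e|{}e]; rewrite ?case_graft //.
  by case: (vertexP e) => [{}e|{}e]; rewrite !case_graft.
rewrite /graft_guest_edge /graft_guest_vertex => e.
case: (edgeP e) => [{}e||{}e]; rewrite !(case_graft, graftE) //.
by case: (edgeP e) => [{}e||{}e]; rewrite !(case_graft, graftE) ?host_root.
Qed.

Definition graft_host_edge X Y Z v u :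
    edge (graft X (host_vertex Y (T' := Z) v u)) ->
    edge (graft Y (host_vertex X u v)) :=
  edge_case
    (edge_case (fun e => host_edge Y _ (host_edge X u e)) (new_edge Y _)
       (fun e => guest_edge _ e))
    (host_edge Y _ (new_edge X u)) (fun e => host_edge Y _ (guest_edge u e)).

Definition graft_host_vertex X Y Z v u :
    vertex (graft X (host_vertex Y (T' := Z) v u)) ->
    vertex (graft Y (host_vertex X u v)) :=
  vertex_case
    (vertex_case (fun e => host_vertex Y _ (host_vertex X u e))
       (fun e => guest_vertex _ e))
    (fun e => host_vertex Y _ (guest_vertex u e)).

(** Graftings at two vertices of one host commute, which is the geometric content of the pre-Lie
    identity. The inverse maps are the same ones with [X], [Y] and [u], [v] exchanged. *)
Lemma graft_host_iso X Y Z v u :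
  tree_iso (@graft_host_edge X Y Z v u) (@graft_host_vertex X Y Z v u).
Proof.
apply: (@tree_iso_can _ _ _ _ (@graft_host_edge Y X Z u v) (@graft_host_vertex Y X Z u v)).
- by rewrite /= -!addnA !addSn ![(_ + (tag _).+1)%N]addnS [(tag X + tag Y)%N]addnC.
- rewrite /graft_host_edge => e; case: (edgeP e) => [{}e||{}e]; rewrite !case_graft //.
  by case: (edgeP e) => [{}e||{}e]; rewrite !case_graft.
- rewrite /graft_host_vertex => e; case: (vertexP e) => [{}e|{}e]; rewrite !case_graft //.
  by case: (vertexP e) => [{}e|{}e]; rewrite !case_graft.
rewrite /graft_host_edge /graft_host_vertex => e.
case: (edgeP e) => [{}e||{}e]; rewrite !(case_graft, graftE) //.
by case: (edgeP e) => [{}e||{}e]; rewrite !(case_graft, graftE) ?host_root.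
Qed.

(** Since [s e <= e], no edge starts at the vertex of largest label: it is a leaf, and cutting the
    last edge leaves an admissibly labelled tree. *)
Lemma graft_leaf_iso T n : tag T = n.+1 ->
  exists T' (v : vertex T') f g, @tree_iso (graft one_vertex v) T f g.
Proof.
case: T => n' [s hs] /= En; move: s hs; rewrite {}En {n'} => s hs.
have sle e : (s e <= e)%N by apply: (forallP hs).
pose s' : {ffun 'I_n -> 'I_n.+1} := [ffun e => inord (s (widen_ord (leqnSn n) e))].
have s'E e : s' e = s (widen_ord (leqnSn n) e) :> nat.
  rewrite ffunE inordK // ltnS; apply: leq_trans (sle _) _.
  exact: ltnW (ltn_ord e).
have hs' : [forall e : 'I_n, s' e <= e]%N.
  by apply/forallP => e; rewrite s'E (leq_trans (sle _)).
pose T' : rtree := Tagged _ (exist _ s' hs').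
pose v : vertex T' := inord (s ord_max).
have vE : v = s ord_max :> nat by rewrite inordK // ltnS; apply: sle.
have En : ((n + 1) = n.+1)%N by rewrite addn1.
have Em : ((n + 1).+1 = n.+2)%N by rewrite addn1.
exists T', v, (cast_ord En), (cast_ord Em).
apply: (@tree_iso_can (graft one_vertex v) (existT _ n.+1 (exist _ s hs))
  (cast_ord En) (cast_ord Em) (cast_ord (esym En)) (cast_ord (esym Em))).
- exact: En.
- by move=> e; apply: val_inj.
- by move=> e; apply: val_inj.
move=> e; split; last exact: val_inj.
apply: val_inj => /=; case: (edgeP e) => [{}e||[]//]; rewrite graftE /= /src /=.
  by rewrite s'E; congr (val (s _)); apply: val_inj.
by rewrite vE; congr (val (s _)); apply: val_inj; rewrite /= addn0.
Qed.

(** Induction by cutting a leaf. The smaller tree is a grafting on its root, and the leaf is put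
    back inside its host or inside its guest, so the outer grafting stays at the root. If the
    smaller tree is a single vertex, the leaf itself is the guest. *)
Lemma graft_root_iso T : tag T = 0%N \/
  exists S S' f g, @tree_iso (graft S (ord0 : vertex S')) T f g.
Proof.
have [n] := ubnP (tag T); elim: n T => // n IHn T.
case ET: (tag T) => [|m] leTn; [by left|right].
have [T' [v [f [g i]]]] := graft_leaf_iso ET.
have Em : (tag T').+1 = m.+1 by rewrite -ET -(iso_size i) /= addn1.
case: (IHn T'); first by rewrite Em.
  move=> T'0; have v0 : v = ord0.
    apply: val_inj; apply/eqP; rewrite -leqn0 /=.
    by apply: (@leq_trans (tag T')); [rewrite -ltnS; apply: ltn_ord|rewrite T'0].
  by exists one_vertex, T'; rewrite -v0; exists f, g.
case=> S [S' [f' [g' i']]].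
have [u gu] := iso_vertex_surj i' v.
have id1 : @tree_iso one_vertex one_vertex id id by split.
have := graft_iso u id1 i'; move: (vertex_case _ _) (edge_case _ _ _).
rewrite gu => {gu} g1 f1 i1; move: (tree_iso_comp i1 i).
move: (_ \o _) (_ \o _) => {}g1 {i1}f1; case: (vertexP u) f1 g1 => {}u f1 g1 i1.
  have := tree_iso_comp (@graft_host_iso S one_vertex S' u ord0) i1.
  rewrite host_root.
  by move=> i2; exists S, (graft one_vertex u); do 2!eexists; exact: i2.
have [f2 [g2 [i2 _ _]]] := tree_iso_inv (@graft_guest_iso one_vertex S S' ord0 u).
by exists (graft one_vertex u), S'; do 2!eexists; exact: tree_iso_comp i2 i1.
Qed.

End TreeIso.

(** * Decorated trees *)

Section Relabel.
Context {A B : choiceType}.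

(** Decorations are pulled back, not pushed forward, so that no inverse of [f] or [g] is
    involved. *)
Definition relabel (T T' : rtree) (f : edge T -> edge T') (g : vertex T -> vertex T')
    (w : deco A B T') : deco A B T :=
  ([ffun e => w.1 (f e)], [ffun u => w.2 (g u)]).

Lemma deco_eq (T : rtree) (w w' : deco A B T) : w.1 =1 w'.1 -> w.2 =1 w'.2 -> w = w'.
Proof. by case: w w' => [x y] [x' y'] /= /ffunP -> /ffunP ->. Qed.

Lemma relabel1 (T T' : rtree) (f : edge T -> edge T') (g : vertex T -> vertex T') w e :
  (relabel f g w).1 e = w.1 (f e).
Proof. by rewrite ffunE. Qed.

Lemma relabel2 (T T' : rtree) (f : edge T -> edge T') (g : vertex T -> vertex T') w u :
  (relabel f g w).2 u = w.2 (g u).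
Proof. by rewrite ffunE. Qed.

Definition relabelE := (relabel1, relabel2).

Section JoinDeco.
Variables (T T' : rtree) (v : vertex T').

Lemma join_edgeH a (w : deco A B T) (w' : deco A B T') e : (join_deco v a w w').1 (host_edge T v e) = w'.1 e.
Proof. by rewrite ffunE split_lshift. Qed.

Lemma join_edgeN a (w : deco A B T) (w' : deco A B T') : (join_deco v a w w').1 (new_edge T v) = a.
Proof. by rewrite ffunE split_rshift unlift_none. Qed.

Lemma join_edgeG a (w : deco A B T) (w' : deco A B T') e : (join_deco v a w w').1 (guest_edge v e) = w.1 e.
Proof. by rewrite ffunE split_rshift liftK. Qed.

Lemma join_vertexH a (w : deco A B T) (w' : deco A B T') u : (join_deco v a w w').2 (host_vertex T v u) = w'.2 u.
Proof. by rewrite ffunE split_lshift. Qed.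

Lemma join_vertexG a (w : deco A B T) (w' : deco A B T') u : (join_deco v a w w').2 (guest_vertex v u) = w.2 u.
Proof. by rewrite ffunE split_rshift. Qed.

Definition joinE := (join_edgeH, join_edgeN, join_edgeG, join_vertexH, join_vertexG).

Lemma join_deco_eq a (w : deco A B T) (w' : deco A B T') (w0 : deco A B (graft T v)) :
  (forall e, w0.1 (host_edge T v e) = w'.1 e) -> w0.1 (new_edge T v) = a ->
  (forall e, w0.1 (guest_edge v e) = w.1 e) ->
  (forall u, w0.2 (host_vertex T v u) = w'.2 u) ->
  (forall u, w0.2 (guest_vertex v u) = w.2 u) -> w0 = join_deco v a w w'.
Proof.
move=> h1 h2 h3 h4 h5; apply: deco_eq => x.
  by case: (edgeP x) => *; rewrite joinE.
by case: (vertexP x) => *; rewrite joinE.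
Qed.

Lemma join_deco_surj (w0 : deco A B (graft T v)) : exists a w w', w0 = join_deco v a w w'.
Proof.
exists (w0.1 (new_edge T v)), (relabel (guest_edge v) (guest_vertex v) w0),
  (relabel (host_edge T v) (host_vertex T v) w0).
by apply: join_deco_eq => // x; rewrite relabelE.
Qed.

End JoinDeco.

Lemma relabel_graft S S' T T' f g f' g' (v : vertex S') a
    (w : deco A B T) (w' : deco A B T') :
  @relabel (graft S v) (graft T (g' v))
    (edge_case (fun e => host_edge T (g' v) (f' e)) (new_edge T (g' v))
       (fun e => guest_edge (g' v) (f e)))
    (vertex_case (fun u => host_vertex T (g' v) (g' u))
       (fun u => guest_vertex (g' v) (g u))) (join_deco (g' v) a w w')
  = join_deco v a (relabel f g w) (relabel f' g' w').
Proof.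
by apply: join_deco_eq => [e||e|u|u]; rewrite !relabelE case_graft joinE ?relabelE.
Qed.

Lemma relabel_graft_guest X Y Z v u a a'
    (w : deco A B X) (w' : deco A B Y) (w'' : deco A B Z) :
  relabel (@graft_guest_edge X Y Z v u) (@graft_guest_vertex X Y Z v u)
    (join_deco v a' (join_deco u a w w') w'')
  = join_deco (guest_vertex v u) a w (join_deco v a' w' w'').
Proof.
apply: join_deco_eq => [e||e|x|x]; rewrite !relabelE /graft_guest_edge /graft_guest_vertex
  !case_graft ?joinE //.
  by case: (edgeP e) => [{}e||{}e]; rewrite !case_graft !joinE.
by case: (vertexP x) => {}x; rewrite !case_graft !joinE.
Qed.

Lemma relabel_graft_host X Y Z v u a a'
    (w : deco A B X) (w' : deco A B Y) (w'' : deco A B Z) :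
  relabel (@graft_host_edge X Y Z v u) (@graft_host_vertex X Y Z v u)
    (join_deco (host_vertex X u v) a' w' (join_deco u a w w''))
  = join_deco (host_vertex Y v u) a w (join_deco v a' w' w'').
Proof.
apply: join_deco_eq => [e||e|x|x]; rewrite !relabelE /graft_host_edge /graft_host_vertex
  !case_graft ?joinE //.
  by case: (edgeP e) => [{}e||{}e]; rewrite !case_graft !joinE.
by case: (vertexP x) => {}x; rewrite !case_graft !joinE.
Qed.

End Relabel.

(* Locked because unification otherwise unfolds the quotient. *)
HB.lock Definition cls (K : fieldType) (A B : choiceType) (T : rtree)
  (w : deco A B T) : TT K A B := << \pi_(dtree_class A B) (Tagged (deco A B) w) >>.

Section Classes.
Context {K : fieldType} {A B : choiceType}.
Local Notation cls := (@cls K A B _).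

Lemma cls_relabel (T T' : rtree) f g (w : deco A B T') :
  @tree_iso T T' f g -> cls (relabel f g w) = cls w.
Proof.
case=> En fI gI sr tg; rewrite cls.unlock; congr << _ >>; apply/eqmodP/isomP.
by split=> //; exists f, g; split=> // x; rewrite ?ffunE ?sr ?tg // /edge_deco /vertex_deco ffunE.
Qed.

(** Functions on [TT] are computed on a chosen representative; this exhibits it as a relabelling of
    the given tree, so that independence of the choice becomes invariance under [relabel]. *)
Lemma repr_cls (T : rtree) (w : deco A B T) :
  let s : dtree A B := repr (\pi_(dtree_class A B) (Tagged (deco A B) w)) in
  exists f g, @tree_iso (tag s) T f g /\ tagged s = relabel f g w.
Proof.
have /eqmodP /isomP := reprK (\pi_(dtree_class A B) (Tagged (deco A B) w)).
case: (repr _) => S ws [En [f [g [fI gI st ha hb]]]]; exists f, g; split.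
  by split=> // e; have [] := st e.
by apply: deco_eq => x; rewrite ffunE; [apply: esym (ha x)|apply: esym (hb x)].
Qed.

Lemma cls_repr (t : dtree_class A B) : << t >> = cls (tagged (repr t : dtree A B)).
Proof.
rewrite cls.unlock; congr << _ >>; rewrite -[LHS]reprK.
by congr (\pi _); case: (repr t).
Qed.

Lemma TT_eq_linear (V : lmodType K) (F G : TT K A B -> V) : linear F -> linear G ->
  (forall (T : rtree) (w : deco A B T), F (cls w) = G (cls w)) -> F =1 G.
Proof. by move=> lF lG FG; apply: malg_eq_linear => // t; rewrite cls_repr. Qed.

Lemma lext_cls (V : lmodType K) (F : dtree_class A B -> V) T (w : deco A B T) :
  lext F (cls w) = F (\pi_(dtree_class A B) (Tagged (deco A B) w)).
Proof. by rewrite cls.unlock lextU. Qed.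

Lemma tree_elt_cls (T : rtree) (w : deco A B T) : tree_elt << w >> = cls w.
Proof. by rewrite cls.unlock; exact: lextU. Qed.

Definition one_deco (b : B) : deco A B one_vertex := (ffun0 (card_ord 0), [ffun=> b]).

Lemma bullet_cls b : @bullet K A B << b >> = cls (one_deco b).
Proof. by rewrite /bullet lextU tree_elt_cls. Qed.

Lemma cls_one_vertex (T : rtree) (w : deco A B T) : tag T = 0%N ->
  exists b, cls w = cls (one_deco b).
Proof.
move=> T0; exists (w.2 ord0).
have T0' : tag one_vertex = tag T by rewrite T0.
have T0'' : (tag one_vertex).+1 = (tag T).+1 by rewrite T0.
have i : @tree_iso one_vertex T (cast_ord T0') (cast_ord T0'').
  by split; [|apply: cast_ord_inj|apply: cast_ord_inj|case|case].
rewrite -(cls_relabel w i); congr cls; apply: deco_eq => x; rewrite !ffunE.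
  by case: x.
by congr (w.2 _); apply: val_inj; rewrite /= [x]ord1.
Qed.

End Classes.

(** * The operators phi_(e, v) and Theta *)

Lemma perm_foldr (I : eqType) (R : Type) (op : I -> R -> R) z s s' :
  (forall i j x, op i (op j x) = op j (op i x)) -> perm_eq s s' ->
  foldr op z s = foldr op z s'.
Proof.
move=> opC; elim: s s' => [|i s IHs] s'; first by rewrite perm_sym => /perm_nilP ->.
move=> ps; have is' : i \in s' by rewrite -(perm_mem ps) mem_head.
case/splitPr: s' / is' ps => s1 s2.
rewrite -[i :: s2]cat1s perm_sym perm_catCA /= perm_cons perm_sym => /IHs ->.
by elim: s1 => //= k s1 <-; rewrite opC.
Qed.

Section LinearExtensionExtra.
Context {K : fieldType}.

Lemma lext_linear (X : choiceType) (V : lmodType K) (F : X -> V) : linear (lext F).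
Proof. exact: linearP. Qed.

Lemma linear_lext (X : choiceType) (U V : lmodType K) (h : U -> V) (F : X -> U) g :
  linear h -> h (lext F g) = lext (h \o F) g.
Proof.
move=> lh; move: g; apply: malg_eq_linear => [||x]; last by rewrite !lextU.
  by apply: linear_compose; last exact: lext_linear.
exact: lext_linear.
Qed.

Lemma lext_exchange (X Y : choiceType) (V : lmodType K) (F : X -> Y -> V) g g' :
  lext (fun x => lext (F x) g') g = lext (fun y => lext (F^~ y) g) g'.
Proof.
move: g; apply: malg_eq_linear => [||x].
- exact: lext_linear.
- by apply: lext_linearl => y; apply: lext_linear.
by rewrite lextU; apply: eq_lext => y; rewrite lextU.
Qed.

End LinearExtensionExtra.

Section PhiAt.
Context {K : fieldType} {A B : choiceType}.
Implicit Type phi psi : {linear {malg K[(A * B)%type]} -> {malg K[(A * B)%type]}}.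

Lemma phi_at_basis phi (T : rtree) (e : edge T) v (w : deco A B T) :
  phi_at phi e v << w >>
    = lext (fun p : A * B => << redecorate e v w p >>) (phi << (w.1 e, w.2 v) >>).
Proof. exact: lextU. Qed.

Lemma phi_at_linear phi (T : rtree) (e : edge T) v : linear (@phi_at K A B phi T e v).
Proof. exact: lext_linear. Qed.

#[local] Opaque phi_at.

(** This covers at once relabelling along an isomorphism and joining with a fixed guest or host: [h]
    only has to preserve the two decorations that are read and commute with their replacement. *)
Lemma phi_at_natural phi (T T' : rtree) (h : deco A B T' -> deco A B T)
    (e : edge T) v (e' : edge T') v' :
  (forall w, (h w).1 e = w.1 e') -> (forall w, (h w).2 v = w.2 v') ->
  (forall w p, redecorate e v (h w) p = h (redecorate e' v' w p)) ->
  forall W : tensor K A B T', phi_at phi e v (lext (fun w => << h w >>) W)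
    = lext (fun w => << h w >>) (phi_at phi e' v' W).
Proof.
move=> h1 h2 hr; apply: malg_eq_linear => [||w].
- by apply: linear_compose; [apply: phi_at_linear|apply: lext_linear].
- by apply: linear_compose; [apply: lext_linear|apply: phi_at_linear].
rewrite lextU !phi_at_basis h1 h2 linear_lext; last exact: lext_linear.
by apply: eq_lext => p /=; rewrite lextU hr.
Qed.

Lemma redecorate1 (T : rtree) (e : edge T) v (w : deco A B T) p f :
  (redecorate e v w p).1 f = if f == e then p.1 else w.1 f.
Proof. by rewrite ffunE. Qed.

Lemma redecorate2 (T : rtree) (e : edge T) v (w : deco A B T) p u :
  (redecorate e v w p).2 u = if u == v then p.2 else w.2 u.
Proof. by rewrite ffunE. Qed.

Definition redecorateE := (redecorate1, redecorate2).

Lemma redecorate_id (T : rtree) (e : edge T) v (w : deco A B T) :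
  redecorate e v w (w.1 e, w.2 v) = w.
Proof. by apply: deco_eq => x; rewrite ffunE; case: eqP => // ->. Qed.

Lemma redecorateK (T : rtree) (e : edge T) v (w : deco A B T) p q :
  redecorate e v (redecorate e v w p) q = redecorate e v w q.
Proof. by apply: deco_eq => x; rewrite !ffunE; case: eqP. Qed.

Lemma redecorateC (T : rtree) (e e' : edge T) v v' (w : deco A B T) p q :
  e != e' -> v != v' ->
  redecorate e v (redecorate e' v' w q) p = redecorate e' v' (redecorate e v w p) q.
Proof.
move=> nee nvv; apply: deco_eq => x; rewrite !ffunE.
  by case: (eqVneq x e) => // ->; rewrite (negPf nee).
by case: (eqVneq x v) => // ->; rewrite (negPf nvv).
Qed.

Lemma phi_at_redecorate phi (T : rtree) (e : edge T) v (w : deco A B T) X :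
  phi_at phi e v (lext (fun p => << redecorate e v w p >>) X)
    = lext (fun p => << redecorate e v w p >>) (phi X).
Proof.
move: X; apply: malg_eq_linear => [||p].
- by apply: linear_compose; [apply: phi_at_linear|apply: lext_linear].
- by apply: linear_compose; [apply: lext_linear|apply: linearP].
rewrite lextU phi_at_basis !ffunE !eqxx -surjective_pairing.
by apply: eq_lext => q; rewrite redecorateK.
Qed.

Lemma phi_at_id (T : rtree) (e : edge T) v (W : tensor K A B T) :
  phi_at idfun e v W = W.
Proof.
move: W; apply: malg_eq_linear => [||w]; [exact: phi_at_linear|exact: linear_id|].
by rewrite phi_at_basis lextU redecorate_id.
Qed.

Lemma phi_atK phi psi (T : rtree) (e : edge T) v : cancel phi psi ->
  cancel (@phi_at K A B phi T e v) (phi_at psi e v).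
Proof.
move=> phiK; apply: malg_eq_linear => [||w].
- by apply: linear_compose; apply: phi_at_linear.
- exact: linear_id.
by rewrite phi_at_basis phi_at_redecorate phiK lextU redecorate_id.
Qed.

Lemma phi13E phi x : phi13 phi << x >>
  = lext (fun y : A * B => << (y.1, x.1.2, y.2) >>) (phi << (x.1.1, x.2) >>).
Proof.
rewrite /phi13 /= /flip12 /phi23 !lextU linear_lext; last exact: lext_linear.
by apply: eq_lext => y /=; rewrite lextU.
Qed.

Lemma phi_at_comm phi (T : rtree) (e e' : edge T) v v' (W : tensor K A B T) :
  tree_compatible phi -> e != e' ->
  phi_at phi e v (phi_at phi e' v' W) = phi_at phi e' v' (phi_at phi e v W).
Proof.
move=> phiC nee; move: W; apply: malg_eq_linear => [||w].
- by apply: linear_compose; apply: phi_at_linear.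
- by apply: linear_compose; apply: phi_at_linear.
(* At distinct vertices the operators touch disjoint slots, and only the order of two sums
   changes. *)
case: (eqVneq v v') => [<-{v'}|nvv]; last first.
  rewrite !phi_at_basis !linear_lext; try exact: phi_at_linear.
  transitivity (lext (fun p => lext (fun q => << redecorate e' v' (redecorate e v w q) p >> : tensor K A B T)
      (phi << (w.1 e, w.2 v) >>)) (phi << (w.1 e', w.2 v') >>)).
    apply: eq_lext => p /=; rewrite phi_at_basis !ffunE (negPf nee) (negPf nvv).
    by apply: eq_lext => q; rewrite redecorateC.
  rewrite lext_exchange; apply: eq_lext => q /=; rewrite phi_at_basis !ffunE.
  by rewrite eq_sym (negPf nee) eq_sym (negPf nvv).
(* [H] embeds the three slots [e], [e'], [v], all other decorations being those of [w]. On its image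
   the two operators become [phi13] and [phi23], to which tree-compatibility applies. *)
pose h (x : A * A * B) : deco A B T :=
  ([ffun k => if k == e then x.1.1 else if k == e' then x.1.2 else w.1 k],
   [ffun u => if u == v then x.2 else w.2 u]).
pose H := lext (fun x : A * A * B => << h x >> : tensor K A B T).
have lH : linear H by apply: lext_linear.
have HU x : H << x >> = << h x >> by rewrite /H lextU.
have HE : H << (w.1 e, w.1 e', w.2 v) >> = << w >>.
  rewrite HU; congr << _ >>.
  by apply: deco_eq => x; rewrite ffunE; do 2?case: eqP => [->|_] //.
have H1 X : phi_at phi e v (H X) = H (phi13 phi X).
  move: X; apply: malg_eq_linear => [||x].
  - by apply: linear_compose; [apply: phi_at_linear|].
  - apply: linear_compose => //; do 2![apply: linear_compose; last exact: lext_linear].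
    exact: lext_linear.
  rewrite HU phi13E (linear_lext _ _ lH) phi_at_basis !ffunE !eqxx.
  apply: eq_lext => y; rewrite /= HU; congr << _ >>.
  by apply: deco_eq => k; rewrite !ffunE; case: eqP.
have H2 X : phi_at phi e' v (H X) = H (phi23 phi X).
  move: X; apply: malg_eq_linear => [||x].
  - by apply: linear_compose; [apply: phi_at_linear|].
  - by apply: linear_compose => //; apply: lext_linear.
  rewrite HU /phi23 lextU (linear_lext _ _ lH) phi_at_basis !ffunE !eqxx.
  rewrite eq_sym (negPf nee).
  apply: eq_lext => y; rewrite /= HU; congr << _ >>.
  apply: deco_eq => k; rewrite !ffunE; last by case: eqP.
  have [->|nke] := eqVneq k e; rewrite ?(negPf nee) //.
  by case: (k == e').
rewrite -HE; apply: (etrans (congr1 _ (H2 _))); apply: (etrans (H1 _)).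
apply/esym/(etrans (congr1 _ (H1 _))); apply: (etrans (H2 _)).
by congr H; apply: esym (phiC _).
Qed.

End PhiAt.

Section Theta.
Context {K : fieldType} {A B : choiceType}.
Implicit Type phi psi : {linear {malg K[(A * B)%type]} -> {malg K[(A * B)%type]}}.
Local Notation tensor := (tensor K A B).
Local Notation cls := (@cls K A B _).
#[local] Opaque phi_at.

(** Composition is not a commutative law, so the big operator cannot be reordered as such; the
    composite along an explicit list of edges can, by [perm_theta_seq]. *)
Definition theta_seq phi (T : rtree) (s : seq (edge T)) (W : tensor T) : tensor T :=
  foldr (fun e => phi_at phi e (src e)) W s.

Lemma Theta_tensorE phi (T : rtree) (W : tensor T) :
  Theta_tensor phi W = theta_seq phi (index_enum (edge T)) W.
Proof.
rewrite /Theta_tensor unlock /reducebig /theta_seq.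
elim: (index_enum _) => [|e s IHs]; first by [].
have IHs' := congr1 (phi_at phi e (src e)) IHs; exact IHs'.
Qed.

Lemma theta_seq_cons phi (T : rtree) (e : edge T) (s : seq (edge T)) (W : tensor T) :
  theta_seq phi (e :: s) W = phi_at phi e (src e) (theta_seq phi s W).
Proof. by []. Qed.

Lemma theta_seq_cat phi (T : rtree) (s s' : seq (edge T)) (W : tensor T) :
  theta_seq phi (s ++ s') W = theta_seq phi s (theta_seq phi s' W).
Proof. by rewrite /theta_seq foldr_cat. Qed.

Lemma theta_seq_linear phi (T : rtree) (s : seq (edge T)) :
  linear (@theta_seq phi T s).
Proof.
elim: s => [|e s IHs]; first exact: linear_id.
exact: linear_compose (phi_at_linear _ _ _) IHs.
Qed.

(** In reversed order the factors cancel from the inside out. The reversal is undone later, by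
    commutation of the factors of [psi]. *)
Lemma theta_seq_rev phi psi (T : rtree) (s : seq (edge T)) (W : tensor T) :
  cancel phi psi -> theta_seq psi (rev s) (theta_seq phi s W) = W.
Proof.
move=> phiK; elim: s => //= e s IHs.
rewrite rev_cons -cats1 theta_seq_cat /= -[RHS]IHs; congr (theta_seq _ _ _).
exact: phi_atK.
Qed.

Section Compatible.
Variable phi : {linear {malg K[(A * B)%type]} -> {malg K[(A * B)%type]}}.
Hypothesis phiC : tree_compatible phi.

Lemma perm_theta_seq (T : rtree) (s s' : seq (edge T)) (W : tensor T) :
  perm_eq s s' -> theta_seq phi s W = theta_seq phi s' W.
Proof.
apply: perm_foldr => e e' X; case: (eqVneq e e') => [-> //|nee].
exact: phi_at_comm.
Qed.

Definition relabel_tensor (T T' : rtree) (f : edge T -> edge T')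
    (g : vertex T -> vertex T') : tensor T' -> tensor T :=
  lext (fun w => << relabel f g w >>).

Lemma phi_at_relabel psi (T T' : rtree) (f : edge T -> edge T')
    (g : vertex T -> vertex T') e v W : injective f -> injective g ->
  phi_at psi e v (relabel_tensor f g W)
    = relabel_tensor f g (phi_at psi (f e) (g v) W).
Proof.
move=> fI gI; apply: (@phi_at_natural K A B psi T T' (relabel f g)) => w.
- by rewrite relabel1.
- by rewrite relabel2.
by move=> p; apply: deco_eq => x; rewrite !ffunE (inj_eq fI, inj_eq gI).
Qed.

Lemma tree_elt_relabel (T T' : rtree) f g (W : tensor T') :
  @tree_iso T T' f g -> tree_elt (relabel_tensor f g W) = tree_elt W.
Proof.
move=> i; move: W; apply: malg_eq_linear => [||w].
- by apply: linear_compose; apply: lext_linear.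
- exact: lext_linear.
by rewrite /relabel_tensor lextU !tree_elt_cls cls_relabel.
Qed.

Lemma theta_seq_relabel (T T' : rtree) f g (s : seq (edge T)) (W : tensor T') :
  @tree_iso T T' f g ->
  theta_seq phi s (relabel_tensor f g W) = relabel_tensor f g (theta_seq phi (map f s) W).
Proof.
move=> i; elim: s => [|e s IHs]; first by [].
rewrite map_cons !theta_seq_cons IHs.
rewrite (phi_at_relabel _ _ _ _ (iso_edge_inj i) (iso_vertex_inj i)).
by rewrite (iso_src i).
Qed.

Lemma tree_elt_linear (T : rtree) : linear (@tree_elt K A B T).
Proof. exact: lext_linear. Qed.

Lemma Theta_linear psi : linear (@Theta K A B psi).
Proof. exact: lext_linear. Qed.

Lemma Theta_tensor_linear psi (T : rtree) : linear (@Theta_tensor K A B psi T).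
Proof.
apply: linear_ext (theta_seq_linear psi (index_enum (edge T))) => W.
by rewrite Theta_tensorE.
Qed.

(** An isomorphism carries the enumeration of the edges of the representative to a permutation of
    that of [T], and [perm_theta_seq] absorbs the permutation. *)
Lemma Theta_tree_elt (T : rtree) (W : tensor T) :
  Theta phi (tree_elt W) = tree_elt (Theta_tensor phi W).
Proof.
move: W; apply: malg_eq_linear => [||w].
- by apply: linear_compose; [apply: Theta_linear|apply: tree_elt_linear].
- by apply: linear_compose; [apply: tree_elt_linear|apply: Theta_tensor_linear].
rewrite tree_elt_cls /Theta lext_cls; have [f [g [i ->]]] := repr_cls w.
rewrite -[X in Theta_tensor phi X](lextU (fun w => << relabel f g w >>)).
rewrite -/(relabel_tensor f g) !Theta_tensorE (theta_seq_relabel _ _ i).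
rewrite (tree_elt_relabel _ i); congr tree_elt; apply: perm_theta_seq.
apply: uniq_perm; rewrite ?(map_inj_uniq (iso_edge_inj i)) ?index_enum_uniq // => e.
have [f' [g' [_ fK _]]] := tree_iso_inv i.
by rewrite -[e]fK map_f !mem_index_enum.
Qed.

Lemma theta_seq_natural (T T' : rtree) (h : deco A B T' -> deco A B T)
    (he : edge T' -> edge T) (hv : vertex T' -> vertex T) (s : seq (edge T')) W :
  (forall e, src (he e) = hv (src e)) ->
  (forall w e, (h w).1 (he e) = w.1 e) -> (forall w v, (h w).2 (hv v) = w.2 v) ->
  (forall w e v p, redecorate (he e) (hv v) (h w) p = h (redecorate e v w p)) ->
  theta_seq phi (map he s) (lext (fun w => << h w >>) W)
    = lext (fun w => << h w >>) (theta_seq phi s W).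
Proof.
move=> hs h1 h2 hr; elim: s => [|e s IHs]; first by [].
rewrite map_cons !theta_seq_cons IHs hs.
by apply: phi_at_natural => w; rewrite ?h1 ?h2.
Qed.

Lemma join_tensor_basis (T T' : rtree) (v : vertex T') a (w : deco A B T) (w' : deco A B T') :
  join_tensor v << a >> << w >> << w' >> = << join_deco v a w w' >> :> tensor _.
Proof. by rewrite /join_tensor !lextU. Qed.

Lemma join_tensor_basisl (T T' : rtree) (v : vertex T') a (w : deco A B T) (W' : tensor T') :
  join_tensor v << a >> << w >> W' = lext (fun w' => << join_deco v a w w' >>) W'.
Proof. by rewrite /join_tensor !lextU. Qed.

Lemma join_tensor_basisr (T T' : rtree) (v : vertex T') a (W : tensor T) (w' : deco A B T') :
  join_tensor v << a >> W << w' >> = lext (fun w => << join_deco v a w w' >>) W.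
Proof. by rewrite /join_tensor !lextU; apply: eq_lext => w; rewrite lextU. Qed.

Lemma join_tensor_linear (T T' : rtree) (v : vertex T') W W' :
  linear (fun a => @join_tensor K A B T T' v a W W').
Proof. exact: lext_linear. Qed.

Lemma join_tensor_linearl (T T' : rtree) (v : vertex T') a W' :
  linear (fun W => @join_tensor K A B T T' v a W W').
Proof. by apply: lext_linearl => i; apply: lext_linear. Qed.

Lemma join_tensor_linearr (T T' : rtree) (v : vertex T') a W :
  linear (fun W' => @join_tensor K A B T T' v a W W').
Proof.
by apply: lext_linearl => i; apply: lext_linearl => w; apply: lext_linear.
Qed.

Lemma redecorate_guest (T T' : rtree) (v : vertex T') a (w : deco A B T)
    (w' : deco A B T') e u p :
  redecorate (guest_edge v e) (guest_vertex v u) (join_deco v a w w') p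
    = join_deco v a (redecorate e u w p) w'.
Proof.
by apply: join_deco_eq => [x||x|x|x] ; rewrite !redecorateE ?graft_eqE ?joinE ?redecorateE.
Qed.

Lemma redecorate_host (T T' : rtree) (v : vertex T') a (w : deco A B T)
    (w' : deco A B T') e u p :
  redecorate (host_edge T v e) (host_vertex T v u) (join_deco v a w w') p
    = join_deco v a w (redecorate e u w' p).
Proof.
by apply: join_deco_eq => [x||x|x|x] ; rewrite !redecorateE ?graft_eqE ?joinE ?redecorateE.
Qed.

Lemma index_enum_graft (T T' : rtree) (v : vertex T') :
  perm_eq (index_enum (edge (graft T v)))
    (new_edge T v :: map (host_edge T v) (index_enum (edge T'))
       ++ map (guest_edge v) (index_enum (edge T))).
Proof.
apply: uniq_perm; first exact: index_enum_uniq.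
  rewrite /= cat_uniq mem_cat !(map_inj_uniq (@host_edge_inj _ _ _)).
  rewrite !(map_inj_uniq (@guest_edge_inj _ _ _)) !index_enum_uniq !andbT /=.
  apply/andP; split.
    by apply/norP; split; apply/mapP => -[e _ /eqP]; rewrite graft_eqE.
  apply/hasPn => _ /mapP[e _ ->]; apply/mapP => -[e' _ /eqP].
  by rewrite graft_eqE.
move=> e; rewrite mem_index_enum inE mem_cat; case: (edgeP e) => [x||x].
- by rewrite map_f ?orbT ?mem_index_enum.
- by rewrite eqxx.
by rewrite (map_f (guest_edge v)) ?orbT ?mem_index_enum.
Qed.

(** The edges are reordered so that the operator of the new edge is applied last; those of guest and
    host edges each act inside one factor of the join, as their sources lie in the same tree. *)
Lemma Theta_tensor_join (T T' : rtree) (v : vertex T') a (W : tensor T) (W' : tensor T') :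
  Theta_tensor phi (join_tensor v a W W')
    = phi_at phi (new_edge T v) (host_vertex T v v)
        (join_tensor v a (Theta_tensor phi W) (Theta_tensor phi W')).
Proof.
rewrite !Theta_tensorE (perm_theta_seq _ (index_enum_graft T v)) /= src_new.
congr phi_at; rewrite theta_seq_cat.
move: (index_enum (edge T)) (index_enum (edge T')) => s s'.
have -> : theta_seq phi (map (guest_edge v) s) (join_tensor v a W W')
    = join_tensor v a (theta_seq phi s W) W'.
  move: a; apply: malg_eq_linear => [||a].
  - exact: linear_compose (theta_seq_linear _ _) (join_tensor_linear _ _ _).
  - exact: join_tensor_linear.
  move: W'; apply: malg_eq_linear => [||w'].
  - exact: linear_compose (theta_seq_linear _ _) (join_tensor_linearr _ _ _).
  - exact: join_tensor_linearr.
  rewrite !join_tensor_basisr (theta_seq_natural (hv := guest_vertex v)) // => [e|w e|w u|w e u p].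
  - by rewrite graftE.
  - by rewrite joinE.
  - by rewrite joinE.
  by rewrite redecorate_guest.
move: (theta_seq phi s W) => {}W.
move: a; apply: malg_eq_linear => [||a].
- exact: linear_compose (theta_seq_linear _ _) (join_tensor_linear _ _ _).
- exact: join_tensor_linear.
move: W; apply: malg_eq_linear => [||w].
- exact: linear_compose (theta_seq_linear _ _) (join_tensor_linearl _ _ _).
- exact: join_tensor_linearl.
rewrite !join_tensor_basisl (theta_seq_natural (hv := host_vertex T v)) // => [e|w' e|w' u|w' e u p].
- by rewrite graftE.
- by rewrite joinE.
- by rewrite joinE.
by rewrite redecorate_host.
Qed.

End Compatible.

End Theta.

(** * Grafting products, their transport by Theta, and the pre-Lie identity for plain grafting *)

Section Tri.
Context {K : fieldType} {A B : choiceType}.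
Implicit Type phi psi : {linear {malg K[(A * B)%type]} -> {malg K[(A * B)%type]}}.
Local Notation tensor := (tensor K A B).
Local Notation cls := (@cls K A B _).
#[local] Opaque phi_at.

Lemma tri_linear phi x y : linear (fun a => @tri K A B phi a x y).
Proof.
apply: lext_linearl => t; apply: lext_linearl => t'; apply: linear_big => v _.
apply: linear_compose; first exact: tree_elt_linear.
exact: linear_compose (phi_at_linear _ _ _) (join_tensor_linear _ _ _).
Qed.

Lemma tri_linearl phi a y : linear (fun x => @tri K A B phi a x y).
Proof. exact: lext_linear. Qed.

Lemma tri_linearr phi a x : linear (@tri K A B phi a x).
Proof. by apply: lext_linearl => t; apply: lext_linear. Qed.

Lemma join_tensor_relabel S S' T T' f g f' g' (v : vertex S') a
    (w : deco A B T) (w' : deco A B T') :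
  join_tensor v a << relabel f g w >> << relabel f' g' w' >>
  = @relabel_tensor K A B (graft S v) (graft T (g' v))
    (edge_case (fun e => host_edge T (g' v) (f' e)) (new_edge T (g' v))
       (fun e => guest_edge (g' v) (f e)))
    (vertex_case (fun u => host_vertex T (g' v) (g' u))
       (fun u => guest_vertex (g' v) (g u)))
    (join_tensor (g' v) a << w >> << w' >>).
Proof.
move: a; apply: malg_eq_linear => [||a].
- exact: join_tensor_linear.
- exact: linear_compose (lext_linear _) (join_tensor_linear _ _ _).
by rewrite !join_tensor_basis -relabel_graft /relabel_tensor lextU.
Qed.

(** Changing the representative of the host permutes the grafting points, so the sum is reindexed by
    the bijection [g']. *)
Lemma tri_cls phi a (T T' : rtree) (w : deco A B T) (w' : deco A B T') :
  tri phi a (cls w) (cls w') = \sum_(v : vertex T')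
    tree_elt (phi_at phi (new_edge T v) (host_vertex T v v)
      (join_tensor v a << w >> << w' >>)).
Proof.
rewrite /tri !lext_cls; have [f [g [i ->]]] := repr_cls w.
have [f' [g' [i' ->]]] := repr_cls w'.
have bg : bijective g'.
  by apply: inj_card_bij (iso_vertex_inj i') _; rewrite !card_ord (iso_size i').
rewrite [RHS](reindex g') /=; last exact: onW_bij.
apply: eq_bigr => v _; have ig := graft_iso v i i'.
rewrite join_tensor_relabel.
rewrite (phi_at_relabel _ _ _ _ (iso_edge_inj ig) (iso_vertex_inj ig)).
by rewrite (tree_elt_relabel _ ig) !case_graft.
Qed.

Lemma tri_tree_elt phi a (T T' : rtree) (W : tensor T) (W' : tensor T') :
  tri phi a (tree_elt W) (tree_elt W') = \sum_(v : vertex T')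
    tree_elt (phi_at phi (new_edge T v) (host_vertex T v v)
      (join_tensor v a W W')).
Proof.
have lP (v : vertex T') : linear (fun X => tree_elt (phi_at phi (new_edge T v) (host_vertex T v v) X)).
  exact: linear_compose (@tree_elt_linear _ _ _ _) (phi_at_linear _ _ _).
move: W; apply: malg_eq_linear => [||w].
- exact: linear_compose (tri_linearl _ _ _) (@tree_elt_linear _ _ _ _).
- apply: linear_big => v _; exact: linear_compose (lP v) (join_tensor_linearl _ _ _).
move: W'; apply: malg_eq_linear => [||w'].
- exact: linear_compose (tri_linearr _ _ _) (@tree_elt_linear _ _ _ _).
- apply: linear_big => v _; exact: linear_compose (lP v) (join_tensor_linearr _ _ _).
by rewrite !tree_elt_cls tri_cls.
Qed.

Lemma tri_id_cls a (T T' : rtree) (w : deco A B T) (w' : deco A B T') :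
  tri idfun << a >> (cls w) (cls w') = \sum_(v : vertex T') cls (join_deco v a w w').
Proof.
rewrite tri_cls; apply: eq_bigr => v _.
by rewrite phi_at_id join_tensor_basis tree_elt_cls.
Qed.

Lemma Theta_tri phi a x y : tree_compatible phi ->
  Theta phi (tri idfun a x y) = tri phi a (Theta phi x) (Theta phi y).
Proof.
move=> phiC; move: x; apply: TT_eq_linear => [||T w].
- exact: linear_compose (Theta_linear _) (tri_linearl _ _ _).
- exact: linear_compose (tri_linearl _ _ _) (Theta_linear _).
move: y; apply: TT_eq_linear => [||T' w'].
- exact: linear_compose (Theta_linear _) (tri_linearr _ _ _).
- exact: linear_compose (tri_linearr _ _ _) (Theta_linear _).
rewrite tri_cls linear_sumE; last exact: Theta_linear.
rewrite -!tree_elt_cls !(Theta_tree_elt phiC) tri_tree_elt; apply: eq_bigr => v _.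
by rewrite phi_at_id (Theta_tree_elt phiC) (Theta_tensor_join phiC).
Qed.

Lemma cancel_Theta phi psi : tree_compatible phi -> tree_compatible psi ->
  cancel phi psi -> cancel (@Theta K A B phi) (Theta psi).
Proof.
move=> phiC psiC phiK; apply: TT_eq_linear => [||T w].
- exact: linear_compose (Theta_linear _) (Theta_linear _).
- exact: linear_id.
rewrite -tree_elt_cls (Theta_tree_elt phiC) (Theta_tree_elt psiC) !Theta_tensorE.
congr tree_elt; rewrite -[RHS](theta_seq_rev (index_enum (edge T)) _ phiK).
by apply: (perm_theta_seq psiC); rewrite perm_sym perm_rev.
Qed.

Lemma Theta_bullet phi b : tree_compatible phi ->
  Theta phi (@bullet K A B b) = @bullet K A B b.
Proof.
move=> phiC; move: b; apply: malg_eq_linear => [||b].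
- exact: linear_compose (Theta_linear _) (lext_linear _).
- exact: lext_linear.
rewrite bullet_cls -tree_elt_cls (Theta_tree_elt phiC) Theta_tensorE.
congr tree_elt; rewrite /theta_seq; case E: (index_enum _) => [//|e s].
by case: e {E}.
Qed.

Lemma tri_id_prelie : multiple_prelie (@tri K A B idfun).
Proof.
split=> [x y|a y|a x|a a' x y z].
- exact: tri_linear.
- exact: tri_linearl.
- exact: tri_linearr.
move: a; apply: malg_eq_linear => [||a].
- apply: linear_sub; first exact: tri_linear.
  by apply: (linear_compose (tri_linearl _ _ _)); apply: tri_linear.
- apply: linear_sub; last exact: tri_linear.
  by apply: (linear_compose (tri_linearr _ _ _)); apply: tri_linear.
move: a'; apply: malg_eq_linear => [||a'].
- apply: linear_sub; last exact: tri_linear.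
  by apply: (linear_compose (tri_linearr _ _ _)); apply: tri_linear.
- apply: linear_sub; first exact: tri_linear.
  by apply: (linear_compose (tri_linearl _ _ _)); apply: tri_linear.
move: x; apply: TT_eq_linear => [||X w].
- apply: linear_sub; first exact: tri_linearl.
  by apply: (linear_compose (tri_linearl _ _ _)); apply: tri_linearl.
- apply: linear_sub; first by apply: (linear_compose (tri_linearr _ _ _)); apply: tri_linearl.
  by apply: (linear_compose (tri_linearl _ _ _)); apply: tri_linearr.
move: y; apply: TT_eq_linear => [||Y w'].
- apply: linear_sub; first by apply: (linear_compose (tri_linearr _ _ _)); apply: tri_linearl.
  by apply: (linear_compose (tri_linearl _ _ _)); apply: tri_linearr.
- apply: linear_sub; first exact: tri_linearl.
  by apply: (linear_compose (tri_linearl _ _ _)); apply: tri_linearl.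
move: z; apply: TT_eq_linear => [||Z w''].
- apply: linear_sub; last exact: tri_linearr.
  exact: linear_compose (tri_linearr _ _ _) (tri_linearr _ _ _).
- apply: linear_sub; last exact: tri_linearr.
  exact: linear_compose (tri_linearr _ _ _) (tri_linearr _ _ _).
(* The graftings of the first tree on a vertex of the guest cancel against the second product. What
   remains is a sum over pairs of vertices of [Z], and exchanging the pair exchanges the two
   trees. *)
have step b b' (S S' : rtree) (u : deco A B S) (u' : deco A B S') :
  tri idfun << b >> (cls u) (tri idfun << b' >> (cls u') (cls w''))
    - tri idfun << b' >> (tri idfun << b >> (cls u) (cls u')) (cls w'')
  = \sum_(v : vertex Z) \sum_(x : vertex Z)
      cls (join_deco (host_vertex S' v x) b u (join_deco v b' u' w'')).
  rewrite !tri_id_cls linear_sumE; last exact: tri_linearr.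
  rewrite (linear_sumE (f := fun x => tri idfun << b' >> x (cls w''))); last first.
    exact: tri_linearl.
  apply/eqP; rewrite subr_eq; apply/eqP.
  under eq_bigr => v _ do rewrite tri_id_cls big_vertex_graft /=.
  rewrite big_split /=; congr (_ + _); rewrite exchange_big /=.
  apply: eq_bigr => x _; rewrite tri_id_cls; apply: eq_bigr => v _.
  by rewrite -relabel_graft_guest (cls_relabel _ (graft_guest_iso _ _ _)).
apply: (etrans (step a a' _ _ w w')); apply: etrans (esym (step a' a _ _ w' w)).
rewrite exchange_big /=; apply: eq_bigr => v _; apply: eq_bigr => x _.
by rewrite -relabel_graft_host (cls_relabel _ (graft_host_iso _ _ _ _)).
Qed.

End Tri.

(** * The value of a tree in a multiple pre-Lie algebra *)

Section Below.
Variable T : rtree.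
Implicit Types u v x y : vertex T.

Definition out u : seq (edge T) := [seq e <- index_enum (edge T) | src e == u].

Lemma mem_out u e : (e \in out u) = (src e == u).
Proof. by rewrite mem_filter mem_index_enum andbT. Qed.

Lemma out_uniq u : uniq (out u).
Proof. by rewrite filter_uniq // index_enum_uniq. Qed.

Lemma src_lt_tgt (e : edge T) : (src e < tgt e)%N.
Proof. by rewrite /= /bump leq0n add1n ltnS src_le. Qed.

Lemma tgt_inj : injective (@tgt T).
Proof. exact: lift_inj. Qed.

Definition child u v := [exists e : edge T, (src e == u) && (tgt e == v)].

Definition below : rel (vertex T) := connect child.

Lemma childP u v : reflect (exists2 e, src e = u & tgt e = v) (child u v).
Proof.
apply: (iffP existsP) => [[e /andP[/eqP eu /eqP ev]]|[e <- <-]]; exists e => //.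
by rewrite !eqxx.
Qed.

Lemma below_refl u : below u u. Proof. exact: connect0. Qed.

Lemma below_out u v e : e \in out u -> below (tgt e) v -> below u v.
Proof.
rewrite mem_out => /eqP eu; apply: connect_trans; apply: connect1.
by apply/childP; exists e.
Qed.

Lemma below_first u v : below u v ->
  v = u \/ exists2 e, e \in out u & below (tgt e) v.
Proof.
case/connectP => -[|x p] /=; [by move=> _ ->; left|].
case/andP => /childP[e eu ex] px ->; right; exists e; first by rewrite mem_out eu.
by rewrite ex; apply/connectP; exists p.
Qed.

Lemma below_last u v : below u v ->
  v = u \/ exists2 e, tgt e = v & below u (src e).
Proof.
case/connectP => p; case/lastP: p => [|p x] /=; first by move=> _ ->; left.
rewrite rcons_path last_rcons => /andP[up /childP[e eu ex]] ->; right.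
by exists e => //; rewrite eu; apply/connectP; exists p.
Qed.

Lemma below_leq u v : below u v -> (u <= v)%N.
Proof.
have [n] := ubnP v; elim: n v => // n IHn v; rewrite ltnS => vn.
case/below_last => [-> //|[e ev /IHn]]; have := src_lt_tgt e; rewrite ev => ev'.
by move=> /(_ (leq_trans ev' vn)) h; apply: leq_trans h (ltnW ev').
Qed.

Lemma below_root v : below ord0 v.
Proof.
have [n] := ubnP v; elim: n v => // n IHn v; rewrite ltnS => vn.
case: (unliftP ord0 v) vn => [e ->|-> _]; last exact: below_refl.
rewrite -[lift _ _]/(tgt e) => en.
apply: connect_trans (IHn _ (leq_trans (src_lt_tgt e) en)) _.
by apply: connect1; apply/childP; exists e.
Qed.

(** A vertex has at most one incoming edge because [tgt] is injective, so two paths ending at [v]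
    agree when read backwards until the shorter one stops. *)
Lemma below_chain x y v : below x v -> below y v -> below x y \/ below y x.
Proof.
have [n] := ubnP v; elim: n v => // n IHn v; rewrite ltnS => vn xv yv.
case: (below_last xv) => [<-|[e ev xe]]; first by right.
case: (below_last yv) => [<-|[e' ev' ye]]; first by left.
have ee : e' = e by apply: tgt_inj; rewrite ev ev'.
rewrite ee in ye; apply: IHn xe ye.
by apply: leq_trans vn; rewrite -ev; apply: src_lt_tgt.
Qed.

Lemma below_tgt_src e u : e \in out u -> below (tgt e) u = false.
Proof.
rewrite mem_out => /eqP <-; apply/negP => /below_leq.
by rewrite leqNgt src_lt_tgt.
Qed.

(** Two children of [u] above a common vertex are comparable, and a child strictly below its sibling
    would put its own source [u] below that sibling. Hence the subtrees at distinct children are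
    disjoint. *)
Lemma below_out_inj u v e e' : e \in out u -> e' \in out u ->
  below (tgt e) v -> below (tgt e') v -> e = e'.
Proof.
move=> eu eu' bv bv'.
wlog bb : e e' eu eu' bv bv' / below (tgt e) (tgt e').
  move=> h; case: (below_chain bv bv') => b; first exact: h.
  by apply/esym/h.
case: (below_last bb) => [/tgt_inj // | [e2 /tgt_inj ->]].
by move: (eu'); rewrite mem_out => /eqP ->; rewrite below_tgt_src.
Qed.

Lemma sum_below (V : zmodType) u (F : vertex T -> V) :
  \sum_(v | below u v) F v
    = F u + \sum_(e <- out u) \sum_(v | below (tgt e) v) F v.
Proof.
rewrite (bigD1 u) ?below_refl //=; congr (_ + _).
rewrite big_mkcond /=; under [RHS]eq_bigr => e _ do rewrite big_mkcond /=.
rewrite exchange_big /=; apply: eq_bigr => v _.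
case: ifPn => [/andP[/below_first[-> /eqP //|[e eu ev]] _]|].
  rewrite (bigD1_seq e) ?out_uniq //= ev big_seq_cond big1 ?addr0 // => e'.
  case/andP => eu' ne; case: ifP => // ev'.
  by rewrite (below_out_inj eu' eu ev' ev) eqxx in ne.
move=> h; rewrite big_seq big1 // => e eu; case: ifP => // ev; case/negP: h.
rewrite (below_out eu ev) /=; apply/eqP => vu.
by rewrite vu (below_tgt_src eu) in ev.
Qed.

End Below.

Lemma out_iso (T T' : rtree) f g u : @tree_iso T T' f g ->
  perm_eq (map f (out u)) (out (g u)).
Proof.
move=> i; apply: uniq_perm; rewrite ?(map_inj_uniq (iso_edge_inj i)) ?out_uniq // => e'.
have [f' [g' [_ fK _]]] := tree_iso_inv i.
rewrite -[e']fK (mem_map (iso_edge_inj i)) !mem_out (iso_src i).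
by rewrite (inj_eq (iso_vertex_inj i)).
Qed.

Section OutGraft.
Variables (T T' : rtree).

Lemma out_guest (v : vertex T') (u : vertex T) :
  perm_eq (map (guest_edge v) (out u)) (out (guest_vertex v u)).
Proof.
apply: uniq_perm; rewrite ?(map_inj_uniq (@guest_edge_inj _ _ _)) ?out_uniq // => e.
case: (edgeP e) => [x||x]; rewrite mem_out graftE graft_eqE.
- by apply/mapP => -[y _ /eqP]; rewrite graft_eqE.
- by apply/mapP => -[y _ /eqP]; rewrite graft_eqE.
by rewrite (mem_map (@guest_edge_inj _ _ _)) mem_out.
Qed.

(** The new edge is listed first so that [brace] unfolds at it. *)
Lemma out_host (v u : vertex T') :
  perm_eq ((if u == v then [:: new_edge T v] else [::]) ++ map (host_edge T v) (out u))
    (out (host_vertex T v u)).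
Proof.
have nN : new_edge T v \notin map (host_edge T v) (out u).
  by apply/mapP => -[y _ /eqP]; rewrite graft_eqE.
apply: uniq_perm; rewrite ?out_uniq //.
  by case: ifP => _ /=; rewrite ?nN (map_inj_uniq (@host_edge_inj _ _ _)) out_uniq.
move=> e; rewrite mem_out mem_cat; case: (edgeP e) => [x||x]; rewrite graftE graft_eqE.
- rewrite (mem_map (@host_edge_inj _ _ _)) mem_out.
  by case: ifP; rewrite // inE graft_eqE.
- by rewrite (negPf nN) orbF eq_sym; case: ifP; rewrite // inE eqxx.
by case: ifP => _; rewrite ?inE ?graft_eqE /=; apply/mapP => -[y _ /eqP];
  rewrite graft_eqE.
Qed.

End OutGraft.

Section TreeValue.
Context {K : fieldType} {A B : choiceType} {L : lmodType K}.
Variables (m : {malg K[A]} -> L -> L -> L) (f : {malg K[B]} -> L).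
Hypothesis hm : multiple_prelie m.

(* [k] is fuel: the value is meaningful once k exceeds the height of u. *)
Fixpoint value_upto (T : rtree) (w : deco A B T) (k : nat) (u : vertex T) : L :=
  if k is k'.+1 then
    brace m (fun e => << w.1 e >>) (f << w.2 u >>) (out u)
      (fun e => value_upto w k' (tgt e))
  else 0.

Lemma value_uptoS (T : rtree) (w : deco A B T) k (u : vertex T) :
  value_upto w k.+1 u = brace m (fun e => << w.1 e >>) (f << w.2 u >>) (out u)
    (fun e => value_upto w k (tgt e)).
Proof. by []. Qed.

(** Labels increase along edges, so the height of [u] is at most [tag T - u]. Passing to a child
    lowers the fuel by one and raises the label by at least one, which preserves the bound. *)
Lemma value_upto_stable (T : rtree) (w : deco A B T) k k' (u : vertex T) :
  (tag T < k + u)%N -> (tag T < k' + u)%N -> value_upto w k u = value_upto w k' u.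
Proof.
have uT : (u < (tag T).+1)%N := ltn_ord u.
elim: k k' u uT => [|k IHk] [|k'] u uT //.
- by rewrite add0n ltnNge -(ltnS u) uT.
- by move=> _; rewrite add0n ltnNge -(ltnS u) uT.
move=> kT kT'; apply: eq_brace => // e; rewrite mem_out => /eqP eu.
have ut : (u < tgt e)%N by rewrite -eu src_lt_tgt.
apply: IHk; first exact: ltn_ord.
  by apply: leq_trans kT _; rewrite addSn -addnS leq_add2l.
by apply: leq_trans kT' _; rewrite addSn -addnS leq_add2l.
Qed.

Definition value (T : rtree) (w : deco A B T) : vertex T -> L :=
  value_upto w (tag T).+1.

Lemma valueE (T : rtree) (w : deco A B T) (u : vertex T) :
  value w u = brace m (fun e => << w.1 e >>) (f << w.2 u >>) (out u)
    (fun e => value w (tgt e)).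
Proof.
apply: eq_brace => // e _; apply: value_upto_stable.
  by rewrite /= /bump leq0n add1n addnS ltnS leq_addr.
by rewrite addSn ltnS leq_addr.
Qed.

(** The isomorphism matches outgoing edges only up to order, so the symmetry of the brace is
    essential here. *)
Lemma value_relabel (T T' : rtree) h g (w : deco A B T') u :
  @tree_iso T T' h g -> value (relabel h g w) u = value w (g u).
Proof.
move=> i; rewrite /value (iso_size i); move: (tag T').+1 => k.
elim: k u => //= k IHk u.
rewrite -(perm_brace hm _ _ _ _ (out_iso u i)).
  rewrite (brace_map _ _ _ _ _ (iso_edge_inj i)) ffunE.
  by apply: eq_brace => e _; rewrite /= ?ffunE // IHk (iso_tgt i).
by rewrite (map_inj_uniq (iso_edge_inj i)) out_uniq.
Qed.

Section Join.
Variables (T T' : rtree) (a : A) (w : deco A B T) (w' : deco A B T').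

Lemma value_guest (v : vertex T') (u : vertex T) :
  value (join_deco v a w w') (guest_vertex v u) = value w u.
Proof.
(* Equality is proved at equal fuel; stability absorbs the difference between the sizes of the two
   trees. *)
suff h k : value_upto (join_deco v a w w') k (guest_vertex v u) = value_upto w k u.
  have nk : (tag (graft T v) < (tag (graft T v)).+1 + u)%N by rewrite addSn ltnS leq_addr.
  rewrite /value h; apply: value_upto_stable; last by rewrite addSn ltnS leq_addr.
  by rewrite /= addSn ltnS addnS -addSn -addnA addnCA leq_addr.
elim: k u => // k IHk u; rewrite !value_uptoS.
rewrite -(perm_brace hm _ _ _ _ (out_guest v u)); last first.
  by rewrite (map_inj_uniq (@guest_edge_inj _ _ _)) out_uniq.
rewrite (brace_map _ _ _ _ _ (@guest_edge_inj _ _ _)) joinE.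
by apply: eq_brace => e _; cbv beta delta [comp]; rewrite ?joinE // graftE IHk.
Qed.

Lemma value_host_rec (v u : vertex T') :
  value (join_deco v a w w') (host_vertex T v u)
  = brace m (fun e => << (join_deco v a w w').1 e >>) (f << w'.2 u >>)
      ((if u == v then [:: new_edge T v] else [::]) ++ map (host_edge T v) (out u))
      (fun e => value (join_deco v a w w') (tgt e)).
Proof.
rewrite valueE joinE; apply/esym/(perm_brace hm); last exact: out_host.
by rewrite (perm_uniq (out_host T v u)) out_uniq.
Qed.

(** The value at [u] depends only on the subtree of [u], which the grafting leaves unchanged. Labels
    grow towards the leaves, whence the induction on [tag T' - u]. *)
Lemma value_host_below (v u : vertex T') : ~~ below u v ->
  value (join_deco v a w w') (host_vertex T v u) = value w' u.
Proof.
have [n] := ubnP (tag T' - u); elim: n u => // n IHn u; rewrite ltnS => un nb.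
have uv : (u == v) = false by apply: contraNF nb => /eqP ->; apply: below_refl.
rewrite value_host_rec uv /= (brace_map _ _ _ _ _ (@host_edge_inj _ _ _)) [RHS]valueE.
apply: eq_brace => e eu; cbv beta delta [comp]; rewrite ?joinE // graftE IHn //.
  move: eu; rewrite mem_out => /eqP eu; apply: leq_trans un; apply: ltn_sub2l.
    by rewrite -eu; apply: leq_trans (ltn_ord e); rewrite ltnS src_le.
  by rewrite -eu src_lt_tgt.
by apply: contra nb; apply: below_out.
Qed.

Lemma sum_value_join (u : vertex T') :
  \sum_(v | below u v) value (join_deco v a w w') (host_vertex T v u)
    = m << a >> (value w ord0) (value w' u).
Proof.
have [n] := ubnP (tag T' - u); elim: n u => // n IHn u; rewrite ltnS => un.
pose c e := value w' (tgt e).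
pose al e : {malg K[A]} := << w'.1 e >>.
pose X := value w ord0.
rewrite sum_below.
(* Grafting on [u] itself makes the new edge the head of the brace, which unfolds into the wanted
   product minus one correction per child. The graftings further down have to supply these
   corrections. *)
have -> : value (join_deco u a w w') (host_vertex T u u)
   = m << a >> X (value w' u)
     - \sum_(e <- out u) brace m al (f << w'.2 u >>) (out u) (upd c e (m << a >> X (c e))).
  have hc e : e \in out u ->
      value (join_deco u a w w') (tgt (host_edge T u e)) = c e.
    by move=> eu; rewrite graftE value_host_below // (below_tgt_src eu).
  rewrite value_host_rec eqxx /= joinE graftE value_guest.
  congr (m _ _ _ - _).
    rewrite (brace_map _ _ _ _ _ (@host_edge_inj _ _ _)) valueE.
    by apply: eq_brace => e eu; cbv beta delta [comp]; rewrite ?joinE // hc.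
  rewrite big_map !big_seq; apply: eq_bigr => e eu.
  rewrite (brace_map _ _ _ _ _ (@host_edge_inj _ _ _)).
  apply: eq_brace => e' eu'; cbv beta delta [comp]; rewrite ?joinE // /upd graft_eqE.
  by case: eqP => _; rewrite hc.
rewrite -[RHS]addr0 -addrA; congr (_ + _); apply/eqP; rewrite addrC subr_eq0; apply/eqP.
rewrite !big_seq; apply: eq_bigr => e eu; rewrite /c.
(* By induction, the product in the entry at [e] is the sum of the graftings in the subtree of [e];
   linearity then takes this sum out of the brace. *)
have := eu; rewrite mem_out => /eqP eu'; rewrite -IHn; last first.
  apply: leq_trans un; apply: ltn_sub2l; last by rewrite -eu' src_lt_tgt.
  by rewrite -eu'; apply: leq_trans (ltn_ord e); rewrite ltnS src_le.
rewrite (linear_sumE _ _ _ (brace_linear hm _ _ _ (out_uniq u) eu)).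
apply: eq_bigr => v bv; rewrite value_host_rec.
have -> : (u == v) = false.
  by apply/eqP => uv; rewrite -uv (below_tgt_src eu) in bv.
rewrite /= (brace_map _ _ _ _ _ (@host_edge_inj _ _ _)).
apply: eq_brace => e' eu2; cbv beta delta [comp]; rewrite ?joinE // graftE /upd; case: eqP => [-> //|ne].
(* A grafting point below the child at [e] lies below no sibling, so the other entries keep their
   values. *)
rewrite value_host_below //; apply/negP => bv'; apply: ne.
exact: below_out_inj eu2 eu bv' bv.
Qed.

Lemma sum_value_join_root :
  \sum_(v : vertex T') value (join_deco v a w w') ord0
    = m << a >> (value w ord0) (value w' ord0).
Proof.
rewrite -sum_value_join; apply: eq_big => [v|v _]; first by rewrite below_root.
by rewrite host_root.
Qed.

End Join.
End TreeValue.

(** * Freeness *)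

Section MplTransport.
Context {K : fieldType} {E L L' : lmodType K}.
Variables (m : E -> L -> L -> L) (m' : E -> L' -> L' -> L') (F : L -> L').
Hypothesis isoF : mpl_isomorphism m m' F.

Lemma mpl_isomorphism_inv : exists2 G, mpl_morphism m' m G & cancel F G /\ cancel G F.
Proof.
have [[lF mF] [G FK GK]] := isoF; exists G => //.
split=> [a x y|a x y]; apply: (canLR FK); first by rewrite lF !GK.
by rewrite mF !GK.
Qed.

Lemma multiple_prelie_iso : multiple_prelie m -> multiple_prelie m'.
Proof.
have [G [lG mG] [FK GK]] := mpl_isomorphism_inv; have [[lF mF] _] := isoF.
have m'E a x y : m' a x y = F (m a (G x) (G y)) by rewrite mF !GK.
case=> la lx ly pl; split=> [x y|a y|a x|a a' x y z].
- by apply: linear_ext (linear_compose lF (la (G x) (G y))) => a; rewrite m'E.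
- by apply: linear_ext (linear_compose lF (linear_compose (lx a (G y)) lG)) => x; rewrite m'E.
- by apply: linear_ext (linear_compose lF (linear_compose (ly a (G x)) lG)) => y; rewrite m'E.
have FB u v : F u - F v = F (u - v).
  by have := lF (-1) v u; rewrite !scaleN1r => e; rewrite addrC -e addrC.
by rewrite !m'E !FK !FB pl.
Qed.

Lemma freely_generated_iso (V : lmodType K) (i : V -> L) (i' : V -> L') :
  freely_generated m i -> (forall b, F (i b) = i' b) -> freely_generated m' i'.
Proof.
have [G [lG mG] [FK GK]] := mpl_isomorphism_inv; have [[lF mF] _] := isoF.
case=> pm free Fi; split=> [|M n f pn]; first exact: multiple_prelie_iso.
have [H [[lH mH] Hi] uH] := free M n f pn; exists (H \o G).
  split; last by move=> b; rewrite /= -Fi FK.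
  by split=> [|a x y /=]; [apply: linear_compose|rewrite mG mH].
move=> H' [lH' mH'] Hi' x; rewrite -[x in LHS]GK.
apply: (uH (H' \o F)) => [|b] /=; last by rewrite Fi.
by split=> [|a u v /=]; [apply: linear_compose|rewrite mF mH'].
Qed.

End MplTransport.

Section Freeness.
Context {K : fieldType} {A B : choiceType}.
Implicit Type phi psi : {linear {malg K[(A * B)%type]} -> {malg K[(A * B)%type]}}.
Local Notation cls := (@cls K A B _).
Local Notation bullet := (@bullet K A B).
#[local] Opaque phi_at tri Theta.

Lemma cls_graft_root (T : rtree) (w : deco A B T) : tag T <> 0%N ->
  exists S S' (v := ord0 : vertex S') a (ws : deco A B S) (ws' : deco A B S'),
    [/\ tag T = tag (graft S v),
        size (out (ord0 : vertex T)) = size (out (ord0 : vertex (graft S v))) &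
        cls w = cls (join_deco v a ws ws')].
Proof.
move=> nT; have [//|[S [S' [f [g i]]]]] := graft_root_iso T.
have [a [ws [ws' e]]] := join_deco_surj (relabel f g w).
exists S, S', a, ws, ws'; split; first by rewrite -(iso_size i).
  by rewrite -(iso_root i) -(perm_size (out_iso _ i)) size_map.
by rewrite -e cls_relabel.
Qed.

Lemma size_out_root (S S' : rtree) (v : vertex S') :
  size (out (ord0 : vertex (graft S v))) = ((v == ord0) + size (out (ord0 : vertex S')))%N.
Proof.
rewrite -(host_root S v) -(perm_size (out_host S v ord0)) size_cat size_map eq_sym.
by case: eqP.
Qed.

Lemma mpl_morphism_unique (L : lmodType K) (m : {malg K[A]} -> L -> L -> L)
    (F G : TT K A B -> L) :
  mpl_morphism (E := {malg K[A]}) (tri idfun) m F ->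
  mpl_morphism (E := {malg K[A]}) (tri idfun) m G ->
  (forall b, F (bullet b) = G (bullet b)) -> F =1 G.
Proof.
case=> lF mF [lG mG] FG; apply: TT_eq_linear => // T w.
(* Two nested inductions: [n] bounds the number of edges and serves the two factors of the product;
   [d] bounds the degree of the root and serves the other graftings, which have as many edges as
   [T]. *)
have [n] := ubnP (tag T); elim: n T w => // n IHn T w; rewrite ltnS => Tn.
have [d] := ubnP (size (out (ord0 : vertex T))).
elim: d T w Tn => // d IHd T w Tn; rewrite ltnS => Td.
have [T0|nT] := eqVneq (tag T) 0%N.
  by have [b ->] := cls_one_vertex (K := K) w T0; rewrite -bullet_cls.
have [S [S' [a [ws [ws' [eT eo ->]]]]]] := cls_graft_root w (elimN eqP nT).
have tS : (tag S < tag T)%N by rewrite eT /= addnS ltnS leq_addl.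
have tS' : (tag S' < tag T)%N by rewrite eT /= addnS ltnS leq_addr.
have := congr1 F (tri_id_cls (K := K) a ws ws').
rewrite mF (IHn _ ws (leq_trans tS Tn)) (IHn _ ws' (leq_trans tS' Tn)) -mG tri_id_cls.
rewrite !linear_sumE // (bigD1 ord0) //= [RHS](bigD1 ord0) //=.
rewrite (eq_bigr (fun v => F (cls (join_deco v a ws ws')))); first by move/addIr.
move=> v nv; apply/esym/IHd; first by rewrite /= -[X in (X <= _)%N]eT.
by rewrite size_out_root (negPf nv) (leq_trans _ Td) // eo size_out_root eqxx.
Qed.

Definition tree_lift (L : lmodType K) (m : {malg K[A]} -> L -> L -> L)
    (f : {malg K[B]} -> L) : TT K A B -> L :=
  lext (fun t : dtree_class A B => value m f (tagged (repr t : dtree A B)) ord0).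

Lemma tree_lift_cls (L : lmodType K) (m : {malg K[A]} -> L -> L -> L) f
    (T : rtree) (w : deco A B T) : multiple_prelie (E := {malg K[A]}) m ->
  tree_lift m f (cls w) = value m f w ord0.
Proof.
move=> hm; rewrite /tree_lift lext_cls; have [h [g [i ->]]] := repr_cls w.
by rewrite (value_relabel _ hm _ _ i) (iso_root i).
Qed.

Lemma tri_id_free : freely_generated (E := {malg K[A]}) (V := {malg K[B]})
  (L := TT K A B) (tri idfun) bullet.
Proof.
split=> [|L m f hm]; first exact: tri_id_prelie.
have [la lx ly _] := hm; pose F := tree_lift m f.
have lF : linear F by apply: lext_linear.
have mF : mpl_morphism (E := {malg K[A]}) (tri idfun) m F.
  split=> // a x y; move: a; apply: malg_eq_linear => [||a].
  - exact: linear_compose lF (tri_linear _ _ _).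
  - exact: la.
  move: x; apply: TT_eq_linear => [||T w].
  - exact: linear_compose lF (tri_linearl _ _ _).
  - exact: linear_compose (lx _ _) lF.
  move: y; apply: TT_eq_linear => [||T' w'].
  - exact: linear_compose lF (tri_linearr _ _ _).
  - exact: linear_compose (ly _ _) lF.
  rewrite tri_id_cls linear_sumE // /F !(tree_lift_cls _ _ hm) -(sum_value_join_root _ hm).
  by apply: eq_bigr => v _; rewrite (tree_lift_cls _ _ hm).
have Fb b : F (bullet b) = f b.
  move: b; apply: malg_eq_linear => [||b].
  - exact: linear_compose lF (lext_linear _).
  - exact: linearP.
  rewrite bullet_cls /F (tree_lift_cls _ _ hm) valueE.
  have -> : out (ord0 : vertex one_vertex) = [::].
    by case: (out _) => [//|[]].
  by rewrite /= ffunE.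
exists F => // G mG Gb; apply: (mpl_morphism_unique mG mF) => b.
by rewrite Gb Fb.
Qed.

Section Transport.
Variables phi psi : {linear {malg K[(A * B)%type]} -> {malg K[(A * B)%type]}}.
Hypotheses (phiC : tree_compatible phi) (psiC : tree_compatible psi).
Hypotheses (phiK : cancel phi psi) (psiK : cancel psi phi).

Let ThetaK : cancel (Theta phi) (Theta psi) := cancel_Theta phiC psiC phiK.
Let ThetaVK : cancel (Theta psi) (Theta phi) := cancel_Theta psiC phiC psiK.

Lemma Theta_isomorphism : mpl_isomorphism (E := {malg K[A]})
  (tri idfun) (tri phi) (@Theta K A B phi).
Proof.
split; last exact: Bijective ThetaK ThetaVK.
by split=> [|a x y]; [apply: Theta_linear|apply: Theta_tri].
Qed.

Lemma tri_free : freely_generated (E := {malg K[A]}) (V := {malg K[B]})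
  (L := TT K A B) (tri phi) bullet.
Proof.
apply: (freely_generated_iso Theta_isomorphism tri_id_free) => b.
exact: Theta_bullet.
Qed.

End Transport.

End Freeness.

(** * The maps phi^lambda *)

From mathcomp Require Import ring mpoly.

(** Both sides count the ordered pairs of disjoint subsets, of sizes [j] and [k], of a set with [b]
    elements. *)
Lemma bin_subC b j k : ('C(b, j) * 'C(b - j, k) = 'C(b, j + k) * 'C(j + k, j))%N.
Proof.
have [le|lt] := leqP (j + k) b; last first.
  rewrite (bin_small lt) mul0n; have [bj|jb] := ltnP b j; first by rewrite bin_small.
  by rewrite ['C(b - j, k)]bin_small ?muln0 // ltn_subLR.
have jb : (j <= b)%N by apply: leq_trans le; apply: leq_addr.
have kb : (k <= b - j)%N by rewrite leq_subRL.
apply/eqP; rewrite -(eqn_pmul2r (fact_gt0 j)) -(eqn_pmul2r (fact_gt0 k)).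
rewrite -(eqn_pmul2r (fact_gt0 (b - j - k))); apply/eqP.
transitivity b`!.
  rewrite -(bin_fact jb) -(bin_fact kb).
  by rewrite -!mulnA; congr (_ * _)%N; rewrite mulnCA.
rewrite -(bin_fact le) -subnDA -(bin_fact (leq_addr k j)) addKn.
by rewrite -!mulnA.
Qed.

Section PhiCoef.
Context {K : fieldType}.

(* The coefficient of phi^c in one variable; it vanishes unless j <= min a b. *)
Definition phi_coef (c : K) (a b j : nat) : K := c ^+ j * 'C(b, j)%:R * (j <= a)%:R.

Lemma phi_coef_mul (c c' : K) a a' b j k :
  phi_coef c a b j * phi_coef c' a' (b - j) k
    = (c ^+ j * c' ^+ k) * ('C(b, j + k) * 'C(j + k, j))%:R * ((j <= a)%:R * (k <= a')%:R).
Proof. by rewrite /phi_coef mulrACA [X in X * _]mulrACA -bin_subC natrM. Qed.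

(** This is tree-compatibility in one variable: two edges lower the same vertex decoration by [j]
    and [k], and the number of choices does not depend on which acts first. *)
Lemma phi_coefC (c : K) a a' b j k :
  phi_coef c a b j * phi_coef c a' (b - j) k = phi_coef c a' b k * phi_coef c a (b - k) j.
Proof.
rewrite !phi_coef_mul [c ^+ k * _]mulrC [(k <= a')%:R * _]mulrC [(k + j)%N]addnC.
by rewrite -(bin_sub (leq_addr k j)) addKn.
Qed.

Lemma phi_coef_small (c : K) a b j : (minn a b < j)%N -> phi_coef c a b j = 0.
Proof.
rewrite gtn_min /phi_coef => /orP[|/bin_small ->]; last by rewrite mulr0 mul0r.
by rewrite ltnNge => /negPf ->; rewrite mulr0.
Qed.

Lemma big_nat_trunc (F : nat -> K) N M : (N <= M)%N ->
  (forall i, (N <= i)%N -> F i = 0) -> \sum_(0 <= i < M) F i = \sum_(0 <= i < N) F i.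
Proof.
move=> NM F0; rewrite (big_cat_nat (leq0n N) NM) /= [X in _ + X]big_nat_cond.
by rewrite [X in _ + X]big1 ?addr0 // => i /andP[/andP[/F0]].
Qed.

(** Only the total lowering [s = j + k] matters to [g]; collecting the terms with given [s] leaves
    the binomial expansion of [(- c + c) ^+ s]. The function [g] stands for the coordinate test on
    the resulting basis vector. *)
Lemma sum_phi_coef_inv (c : K) (g : nat -> K) a b N : (b < N)%N ->
  \sum_(j < N) \sum_(k < N) phi_coef c a b j * phi_coef (- c) (a - j) (b - j) k * g (j + k)%N
    = g 0%N.
Proof.
move=> bN.
pose S s := 'C(b, s)%:R * (s <= a)%:R * g s.
pose T j s := S s * (c ^+ j * (- c) ^+ (s - j) *+ 'C(s, j)).
transitivity (\sum_(0 <= j < N) \sum_(0 <= s < N) T j s).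
  rewrite big_mkord; apply: eq_bigr => j _.
  transitivity (\sum_(0 <= k < N) T j (k + j)%N).
    rewrite big_mkord; apply: eq_bigr => k _.
    rewrite phi_coef_mul /T /S addnK [(k + j)%N]addnC -natrM mulnb.
    (* Subtraction is truncated, so [k <= a - j] alone would still allow [k = 0] when [j > a]. *)
    have -> : ((j <= a) && (k <= a - j) = (j + k <= a))%N.
      have [ja|aj] /= := leqP j a; first by rewrite leq_subRL.
      by apply/esym/negbTE; rewrite -ltnNge (leq_trans aj) // leq_addr.
    rewrite natrM -[X in _ = _ * X]mulr_natr.
    rewrite mulr_natr; ring.
  transitivity (\sum_(j <= s < N + j) T j s).
    by rewrite -[RHS]/(\sum_(0 + j <= s < N + j) T j s) big_addn addnK.
  (* The range of [s] can be made independent of [j]: below [j] the factor C(s, j) vanishes, and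
     from [N] on C(b, s) vanishes because [b < N]. *)
  have T0 s : (s < j)%N -> T j s = 0 by move=> sj; rewrite /T bin_small ?mulr0n ?mulr0.
  have TN s : (N <= s)%N -> T j s = 0.
    by move=> Ns; rewrite /T /S bin_small ?mul0r // (leq_trans bN).
  rewrite -(big_nat_trunc (leq_addr j N) TN) [RHS](big_cat_nat (n := j)) ?leq_addl //=.
  by rewrite [X in X + _]big_nat_cond [X in X + _]big1 ?add0r // => s /andP[/andP[_ /T0]].
rewrite exchange_big /= (eq_big_nat _ _ (F2 := fun s => if s == 0%N then g s else 0)).
  rewrite (@big_nat_trunc _ 1); last by case.
    by rewrite big_nat1.
  by apply: leq_trans bN.
move=> s /andP[_ sN]; rewrite -mulr_sumr (@big_nat_trunc _ s.+1) //; last first.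
  by move=> j js; rewrite bin_small // mulr0n.
have -> : \sum_(0 <= j < s.+1) c ^+ j * (- c) ^+ (s - j) *+ 'C(s, j) = (s == 0%N)%:R.
  have := exprDn (- c) c s; rewrite addNr expr0n => ->.
  by rewrite big_mkord; apply: eq_bigr => i _; rewrite mulrC.
by case: s {sN} => [|s]; rewrite ?mulr0 // /S bin0 leq0n !mul1r mulr1.
Qed.

End PhiCoef.

Section PhiLambda.
Context {K : fieldType} {d : nat}.

Implicit Types (lam : 'rV[K]_d.+1) (a b x y : 'X_{1..d.+1}).
Local Notation box N := {ffun 'I_d.+1 -> 'I_N}.

Definition box_mnm N (l : box N) : 'X_{1..d.+1} := [multinom nat_of_ord (l i) | i < d.+1].

Lemma box_mnmE N (l : box N) i : box_mnm l i = l i.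
Proof. exact: mnmE. Qed.

Definition phi_coefs lam a b N (l : box N) : K :=
  \prod_i phi_coef (lam 0 i) (a i) (b i) (l i).

Lemma phi_coefs_eq0 lam a b N (l : box N) :
  ~~ [forall i, (l i <= minn (a i) (b i))%N] -> phi_coefs lam a b l = 0.
Proof.
rewrite negb_forall => /existsP[i]; rewrite -ltnNge => li.
by rewrite /phi_coefs (bigD1 i) //= phi_coef_small // mul0r.
Qed.

(** A bound on the total degree does not factor over the coordinates, whereas a sum over a box does.
    The constraint [l <= min(a, b)] is carried by the vanishing of the coefficients, so any large
    enough [N] will do. *)
Lemma phi_lambda_box lam a b N : (forall i, (b i < N)%N) ->
  phi_lambda lam << (a, b) : multiindex d * multiindex d >>
  = \sum_(l : box N) phi_coefs lam a b l *:
      << ((a - box_mnm l)%MM, (b - box_mnm l)%MM) : multiindex d * multiindex d >>.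
Proof.
move=> bN; case: N bN => [/(_ ord0)//|N bN].
rewrite /phi_lambda /= lextU [RHS](bigID (fun l : box N.+1 =>
  [forall i, (l i <= minn (a i) (b i))%N])) /= [X in _ + X]big1 ?addr0; last first.
  by move=> l nl; rewrite phi_coefs_eq0 // scale0r.
pose h (l : 'X_{1..d.+1 < (mdeg b).+1}) : box N.+1 := [ffun i => inord (bmnm l i)].
pose h' (l : box N.+1) : 'X_{1..d.+1 < (mdeg b).+1} := insubd bm0 (box_mnm l).
have h'E (l : box N.+1) : [forall i, (l i <= minn (a i) (b i))%N] -> bmnm (h' l) = box_mnm l.
  move=> /forallP le; rewrite /h' -[bmnm _]/(val _) insubdK //.
  rewrite unfold_in /= ltnS !mdegE; apply: leq_sum => i _; rewrite box_mnmE.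
  exact: leq_trans (le i) (geq_minr _ _).
have hE (l : 'X_{1..d.+1 < (mdeg b).+1}) : [forall i, (bmnm l i <= minn (a i) (b i))%N] ->
    forall i, h l i = bmnm l i :> nat.
  move=> /forallP le i; rewrite ffunE inordK //.
  by apply: leq_ltn_trans (bN i); apply: leq_trans (le i) (geq_minr _ _).
rewrite [RHS](reindex_onto h h') /=; last first.
  move=> l ok; apply/ffunP => i; apply: ord_inj; rewrite hE h'E ?box_mnmE //.
  by apply/forallP => j; rewrite box_mnmE (forallP ok).
apply: eq_big => l.
  apply/idP/andP => [ok|[ok /eqP <-]]; last first.
    by rewrite h'E //; apply/forallP => i; rewrite box_mnmE (forallP ok).
  have ok' : [forall i, (h l i <= minn (a i) (b i))%N].
    by apply/forallP => i; rewrite hE // (forallP ok).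
  split=> //; apply/eqP/val_inj; rewrite /= h'E //.
  by apply/mnmP => i; rewrite box_mnmE hE.
move=> ok; have hl : box_mnm (h l) = bmnm l.
  by apply/mnmP => i; rewrite box_mnmE hE.
have hc : phi_coefs lam a b (h l)
    = (\prod_i lam 0 i ^+ bmnm l i) * (\prod_i 'C(b i, bmnm l i))%N%:R.
  rewrite /phi_coefs natr_prod -big_split /=; apply: eq_bigr => i _.
  rewrite hE // /phi_coef.
  by have := forallP ok i; rewrite leq_min => /andP[-> _]; rewrite mulr1.
by rewrite hl hc.
Qed.

#[local] Opaque phi_lambda.

Lemma lext_phi_lambda (V : lmodType K) (g : multiindex d * multiindex d -> V) lam a b N :
  (forall i, (b i < N)%N) ->
  lext g (phi_lambda lam << (a, b) : multiindex d * multiindex d >>)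
  = \sum_(l : box N) phi_coefs lam a b l *: g ((a - box_mnm l)%MM, (b - box_mnm l)%MM).
Proof.
move=> bN; have lg := lext_linear g.
rewrite (phi_lambda_box _ _ bN) (linear_sumE _ _ _ lg); apply: eq_bigr => l _.
by rewrite (linear_scale _ _ lg) lextU.
Qed.

(** A single bound for [b] and all its lowerings lets two successive applications of phi^lambda use
    the same box. *)
Lemma mnm_bound b : exists2 N, (forall i, (b i < N)%N) & forall c i, ((b - c)%MM i < N)%N.
Proof.
have bN i : (b i < (mdeg b).+1)%N by rewrite ltnS mdegE (bigD1 i) //= leq_addr.
exists (mdeg b).+1 => // c i; rewrite mnmBE.
exact: leq_ltn_trans (leq_subr _ _) (bN i).
Qed.

Let key3 a1 a2 b : multiindex d * multiindex d * multiindex d := (a1, a2, b).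

Lemma phi23_lambda lam a1 a2 b N : (forall i, (b i < N)%N) ->
  phi23 (phi_lambda lam) << key3 a1 a2 b >>
  = \sum_(l : box N) phi_coefs lam a2 b l *: << key3 a1 (a2 - box_mnm l) (b - box_mnm l) >>.
Proof. by move=> bN; rewrite /phi23 lextU; apply: lext_phi_lambda. Qed.

Lemma phi13_lambda lam a1 a2 b N : (forall i, (b i < N)%N) ->
  phi13 (phi_lambda lam) << key3 a1 a2 b >>
  = \sum_(l : box N) phi_coefs lam a1 b l *: << key3 (a1 - box_mnm l) a2 (b - box_mnm l) >>.
Proof. by move=> bN; rewrite phi13E; apply: lext_phi_lambda. Qed.

Lemma phi13_linear lam : linear (phi13 (phi_lambda lam)).
Proof.
have lf : linear (@flip12 K (multiindex d) (multiindex d)) by apply: lext_linear.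
have l23 : linear (phi23 (phi_lambda lam)) by apply: lext_linear.
exact: linear_compose lf (linear_compose l23 lf).
Qed.

Lemma phi23_linear lam : linear (phi23 (phi_lambda lam)).
Proof. exact: lext_linear. Qed.

#[local] Opaque phi13 phi23.

Lemma phi_lambda_compatible lam : tree_compatible (phi_lambda lam).
Proof.
apply: malg_eq_linear => [||[[a1 a2] b]].
- exact: linear_compose (phi13_linear _) (phi23_linear _).
- exact: linear_compose (phi23_linear _) (phi13_linear _).
have l13 := phi13_linear lam; have l23 := phi23_linear lam.
have [N bN bcN] := mnm_bound b.
rewrite -/(key3 a1 a2 b).
have E1 : phi13 (phi_lambda lam) (phi23 (phi_lambda lam) << key3 a1 a2 b >>)
  = \sum_(l : box N) \sum_(k : box N)
     (phi_coefs lam a2 b l * phi_coefs lam a1 (b - box_mnm l) k) *: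
      << key3 (a1 - box_mnm k) (a2 - box_mnm l) (b - box_mnm l - box_mnm k) >>.
  rewrite (phi23_lambda _ _ _ bN) (linear_sumE _ _ _ l13).
  apply: eq_bigr => l _; rewrite (linear_scale _ _ l13) (phi13_lambda _ _ _ (bcN _)).
  by rewrite scaler_sumr; apply: eq_bigr => k _; rewrite scalerA.
have E2 : phi23 (phi_lambda lam) (phi13 (phi_lambda lam) << key3 a1 a2 b >>)
  = \sum_(k : box N) \sum_(l : box N)
     (phi_coefs lam a1 b k * phi_coefs lam a2 (b - box_mnm k) l) *:
      << key3 (a1 - box_mnm k) (a2 - box_mnm l) (b - box_mnm k - box_mnm l) >>.
  rewrite (phi13_lambda _ _ _ bN) (linear_sumE _ _ _ l23).
  apply: eq_bigr => k _; rewrite (linear_scale _ _ l23) (phi23_lambda _ _ _ (bcN _)).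
  by rewrite scaler_sumr; apply: eq_bigr => l _; rewrite scalerA.
suff E : phi13 (phi_lambda lam) (phi23 (phi_lambda lam) << key3 a1 a2 b >>)
  = phi23 (phi_lambda lam) (phi13 (phi_lambda lam) << key3 a1 a2 b >>) by exact: E.
rewrite E1 E2.
(* After exchanging the sums, the two sides agree term by term, the coefficients coordinate by
   coordinate. *)
apply: sum_swap => l k.
have -> : phi_coefs lam a2 b l * phi_coefs lam a1 (b - box_mnm l) k
    = phi_coefs lam a1 b k * phi_coefs lam a2 (b - box_mnm k) l.
  rewrite /phi_coefs -!big_split /=; apply: eq_bigr => i _.
  by rewrite !mnmBE !box_mnmE phi_coefC.
suff -> : (b - box_mnm l - box_mnm k = b - box_mnm k - box_mnm l)%MM by [].
by apply/mnmP => i; rewrite !mnmBE subnAC.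
Qed.

End PhiLambda.

Lemma natr_forall (K : fieldType) (I : finType) (P : pred I) :
  [forall i, P i]%:R = \prod_i (P i)%:R :> K.
Proof.
case: forallP => [allP|nP]; first by rewrite big1 // => i _; rewrite allP.
have /existsP[i /negPf Pi] : [exists i, ~~ P i].
  by rewrite -negb_forall; apply/forallP.
by rewrite (bigD1 i) //= Pi mul0r.
Qed.

Lemma prod_sum2 (K : fieldType) (I J : finType) (F : I -> J -> J -> K) :
  \prod_i \sum_j \sum_k F i j k
    = \sum_(l : {ffun I -> J}) \sum_(k : {ffun I -> J}) \prod_i F i (l i) (k i).
Proof. by rewrite bigA_distr_bigA; apply: eq_bigr => l _; rewrite bigA_distr_bigA. Qed.

Lemma mcoeff_sum (K : fieldType) (X : choiceType) (x : X) (I : Type) (r : seq I)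
    (F : I -> {malg K[X]}) :
  monalg.mcoeff x (\sum_(i <- r) F i) = \sum_(i <- r) monalg.mcoeff x (F i).
Proof.
elim: r => [|i r IHr]; first by rewrite !big_nil monalg.mcoeff0.
by rewrite !big_cons monalg.mcoeffD IHr.
Qed.

Section PhiLambdaInverse.
Context {K : fieldType} {d : nat}.
Local Notation box N := {ffun 'I_d.+1 -> 'I_N}.
Let key2 (a b : 'X_{1..d.+1}) : multiindex d * multiindex d := (a, b).
#[local] Opaque phi_lambda.

(** Writing the test for equality of basis vectors as a product over the coordinates makes the
    coefficients factor. *)
Lemma mcoeff_key2 a b x y :
  monalg.mcoeff (key2 x y) << key2 a b >> = \prod_i ((a i == x i) && (b i == y i))%:R :> K.
Proof.
rewrite monalg.mcoeffU -(natr_forall _ (fun i => (a i == x i) && (b i == y i))).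
congr (_ *+ nat_of_bool _).
apply/eqP/forallP => [[-> ->] i|ab]; first by rewrite !eqxx.
by congr (_, _); apply/mnmP => i; have /andP[/eqP ai /eqP bi] := ab i.
Qed.

Lemma phi_lambdaK (lam : 'rV[K]_d.+1) :
  cancel (phi_lambda lam) (phi_lambda (- lam)).
Proof.
have lp := linearP (phi_lambda (- lam)).
apply: malg_eq_linear => [||[a b]].
- exact: linear_compose lp (linearP (phi_lambda lam)).
- exact: linear_id.
have [N bN bcN] := mnm_bound b; rewrite -/(key2 a b).
have E : phi_lambda (- lam) (phi_lambda lam << key2 a b >>)
  = \sum_(l : box N) \sum_(k : box N)
     (phi_coefs lam a b l * phi_coefs (- lam) (a - box_mnm l) (b - box_mnm l) k) *:
      << key2 (a - box_mnm l - box_mnm k) (b - box_mnm l - box_mnm k) >>.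
  apply: (etrans (congr1 (phi_lambda (- lam)) (phi_lambda_box lam a bN))).
  apply: (etrans (linear_sumE _ _ _ lp)); apply: eq_bigr => l _.
  apply: (etrans (linear_scale _ _ lp)).
  apply: (etrans (congr1 _ (phi_lambda_box (- lam) (a - box_mnm l)%MM (bcN _)))).
  by rewrite scaler_sumr; apply: eq_bigr => k _; rewrite scalerA.
apply: (etrans E) => {E}; apply/malgP => -[x y]; rewrite -/(key2 x y).
rewrite mcoeff_sum; under eq_bigr => l _ do rewrite mcoeff_sum.
(* [g i s] tests whether a total lowering by [s] in coordinate [i] reaches [x i] and [y i]. With it
   the double sum over boxes becomes a product over [i] of one-variable sums. *)
pose g i s : K := ((a i - s == x i)%N && (b i - s == y i)%N)%:R.
transitivity (\prod_i g i 0%N); last first.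
  by rewrite mcoeff_key2; apply: eq_bigr => i _; rewrite /g !subn0.
under [RHS]eq_bigr => i _ do rewrite -(sum_phi_coef_inv (lam 0 i) (g i) (a i) (bN i)).
rewrite prod_sum2; apply: eq_bigr => l _; apply: eq_bigr => k _.
rewrite monalg.mcoeffZ mcoeff_key2 /phi_coefs -!big_split /=; apply: eq_bigr => i _.
by rewrite !mnmBE !box_mnmE mxE /g !subnDA.
Qed.

End PhiLambdaInverse.

Theorem theorem4p6 (K : fieldType) (hK : [pchar K] =i pred0) (d : nat)
    (lam : 'rV[K]_d.+1) :
  tree_compatible (phi_lambda lam) /\
  freely_generated (E := D_s K d) (V := D_s K d)
    (L := TT K (multiindex d) (multiindex d))
    (tri (phi_lambda lam))
    (@bullet K (multiindex d) (multiindex d)) /\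
  mpl_isomorphism (E := D_s K d)
    (tri idfun) (tri (phi_lambda lam)) (Theta (phi_lambda lam)) /\
  cancel (Theta (phi_lambda lam)) (Theta (phi_lambda (- lam))) /\
  cancel (Theta (phi_lambda (- lam))) (Theta (phi_lambda lam)).
Proof.
have lamC := @phi_lambda_compatible K d.
have lamK : cancel (phi_lambda lam) (phi_lambda (- lam)) := phi_lambdaK lam.
have lamVK : cancel (phi_lambda (- lam)) (phi_lambda lam).
  by have := phi_lambdaK (- lam); rewrite opprK.
split; first exact: lamC.
split; first exact: tri_free (lamC _) (lamC _) lamK lamVK.
split; first exact: Theta_isomorphism (lamC _) (lamC _) lamK lamVK.
split; first exact: cancel_Theta (lamC _) (lamC _) lamK.
exact: cancel_Theta (lamC _) (lamC _) lamVK.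
Qed.
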